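(* Let $F=f+\psi$ on $\mathbb{R}^d$, where $f:\mathbb{R}^d\to\mathbb{R}$ is convex and three times differentiable with $M$-Lipschitz continuous Hessian, $\psi:\mathbb{R}^d\to\mathbb{R}\cup\{+\infty\}$ is proper, closed and convex, and $F$ has a minimizer $x^*$; put $F^*=F(x^* )$. Suppose that $f$ is $\mu$-strongly convex with $\mu>0$, i.e. $\nabla^2 f(x)\succeq\mu\mathbf{I}^d$ for all $x\in\mathbb{R}^d$, that the distribution $\mathcal{D}$ of random matrices satisfies $\mathbb{E}[\mathbf{P}^{\mathbf{S}}]=\frac{\tau}{d}\mathbf{I}^d$ for some $\tau>0$, and that $\psi$ is $\mathrm{Range}(\mathcal{D})$-separable. Let $\{x^k\}_{k\ge0}$ be generated by SSCN from $x^0$, let $$R:=\sup_{x\in\mathbb{R}^d}\left\{\|x-x^*\|\;:\;F(x)\le F(x^0)\right\},$$ and let $L$ be such that $\nabla^2 f(x)\preceq L\mathbf{I}^d$ for all $x$ with $F(x)\le F(x^0)$ (for instance $L=\lambda_{\max}(\nabla^2 f(x^* ))+MR$). Then $\mathbb{E}[F(x^k)]-F^*\le\varepsilon$ as soon as the number of iterations $k$ is $$k=\mathcal{O}\left(\left(\frac{d-\tau}{\tau}\frac{L}{\mu}+\frac{d}{\tau}\sqrt{\frac{MR}{\mu}}+\frac{d}{\tau}\right)\log\left(\frac{F(x^0)-F^*}{\varepsilon}\right)\right);$$ that is, there is a universal constant $C>0$ such that for every $0<\varepsilon<F(x^0)-F^*$ the inequality $\mathbb{E}[F(x^k)]-F^*\le\varepsilon$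 holds for all integers $k\ge C\left(\frac{d-\tau}{\tau}\frac{L}{\mu}+\frac{d}{\tau}\sqrt{\frac{MR}{\mu}}+\frac{d}{\tau}\right)\log\frac{F(x^0)-F^*}{\varepsilon}$.
   Context: $\|\cdot\|$ is the Euclidean norm and $\mathbf{I}^q$ the $q\times q$ identity. Distribution: $\mathcal{D}$ is a fixed distribution of random matrices $\mathbf{S}\in\mathbb{R}^{d\times\tau(\mathbf{S})}$ (the number of columns $\tau(\mathbf{S})$ may be random) having full column rank with probability one. $\mathbf{P}^{\mathbf{S}}:=\mathbf{S}(\mathbf{S}^\top\mathbf{S})^{-1}\mathbf{S}^\top$ is the orthogonal projection onto the range of $\mathbf{S}$. $\mathrm{Range}(\mathcal{D})$ denotes the set of matrices that $\mathcal{D}$ takes as values. Subspace quantities: $\nabla_{\mathbf{S}}f(x):=\mathbf{S}^\top\nabla f(x)$, $\nabla^2_{\mathbf{S}}f(x):=\mathbf{S}^\top\nabla^2 f(x)\mathbf{S}$, and $$M_{\mathbf{S}}:=\max_{x\in\mathbb{R}^d}\max_{h\in\mathbb{R}^{\tau(\mathbf{S})},\,h\ne0}\frac{|\nabla^3 f(x)[\mathbf{S}h]^3|}{\|\mathbf{S}h\|^3}.$$ Algorithm SSCN (Stochastic Subspace Cubic Newton): start from $x^0$; for $k=0,1,\dots$ sample $\mathbf{S}\sim\mathcal{D}$ independently of the past, let $h^k=\arg\min_{h\in\mathbb{R}^{\tau(\mathbf{S})}}T_{\mathbf{S}}(x^k,h)$, where $$T_{\mathbf{S}}(x,h):=\langle\nabla_{\mathbf{S}}f(x),h\rangle+\tfrac12\langle\nabla^2_{\mathbf{S}}f(x)h,h\rangle+\tfrac{M_{\mathbf{S}}}{6}\|\mathbf{S}h\|^3+\psi(x+\mathbf{S}h),$$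 and set $x^{k+1}=x^k+\mathbf{S}h^k$. Separability: for a set $D$ of full-column-rank matrices with $d$ rows, a set $Q\subseteq\mathbb{R}^d$ is $D$-separable if $\mathbf{P}^{\mathbf{S}}x+(\mathbf{I}^d-\mathbf{P}^{\mathbf{S}})y\in Q$ for all $x,y\in Q$ and $\mathbf{S}\in D$. A function $\phi:\mathbb{R}^d\to\mathbb{R}\cup\{+\infty\}$ is $D$-separable if $\mathrm{dom}\,\phi$ is $D$-separable and there is a map $\phi':\mathrm{dom}\,\phi\to\mathbb{R}^d$ such that (1) $\phi(x)=\langle\phi'(x),e\rangle$ for all $x\in\mathrm{dom}\,\phi$, where $e$ is the all-ones vector, and (2) $\phi'(\mathbf{P}^{\mathbf{S}}x+(\mathbf{I}^d-\mathbf{P}^{\mathbf{S}})y)=\mathbf{P}^{\mathbf{S}}\phi'(x)+(\mathbf{I}^d-\mathbf{P}^{\mathbf{S}})\phi'(y)$ for all $x,y\in\mathrm{dom}\,\phi$, $\mathbf{S}\in D$. *)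

(* Defs.v *)
From HB Require Import structures.
From mathcomp Require Import all_boot all_order all_algebra.
From mathcomp Require Import all_classical all_reals all_analysis.

Set Implicit Arguments.
Unset Strict Implicit.
Unset Printing Implicit Defensive.
Import Order.TTheory GRing.Theory Num.Theory.
Import numFieldNormedType.Exports.

Local Open Scope classical_set_scope.
Local Open Scope ring_scope.

(* The library norm on matrices is the max norm: it is used only for the
   topology and for differentiability, which do not depend on the choice of
   the norm in finite dimension. *)
Section Euclidean.
Context {R : realType} {n : nat}.

Definition dotp (u v : 'cV[R]_n) : R := \sum_i u i ord0 * v i ord0.

Definition enorm (u : 'cV[R]_n) : R := Num.sqrt (dotp u u).

(* Symmetry is not part of the definition: the Loewner order is only applied
   to Hessians of twice differentiable functions and to multiples of the
   identity. *)
Definition psd (A : 'M[R]_n) : Prop := forall h, 0 <= dotp (A *m h) h.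

Definition loewner_le (A B : 'M[R]_n) : Prop := psd (B - A).

End Euclidean.

Section Calculus.
Context {R : realType} {d : nat}.
Implicit Types (f : 'cV[R]_d -> R) (x h : 'cV[R]_d).

Definition gradient f x : 'cV[R]_d := \col_i 'D_(delta_mx i ord0) f x.

Definition hessian f x : 'M[R]_d :=
  \matrix_(i, j) 'D_(delta_mx j ord0) (fun y => gradient f y i ord0) x.

(* The diagonal D^3 f(x)[h, h, h] of the third derivative. *)
Definition third_derivative f x h : R :=
  dotp ('D_h (hessian f) x *m h) h.

Definition three_times_differentiable f : Prop :=
  [/\ forall x, differentiable f x,
      forall x, differentiable (gradient f) x
    & forall x, differentiable (hessian f) x].

(* Lipschitz continuity of the Hessian in the operator norm induced by the
   Euclidean norm. *)
Definition lipschitz_hessian (M : R) f : Prop :=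
  forall x y h,
    enorm ((hessian f x - hessian f y) *m h) <= M * enorm (x - y) * enorm h.

End Calculus.

Section ExtendedFunctions.
Context {R : realType} {d : nat}.
Implicit Types (phi : 'cV[R]_d -> \bar R).
Local Open Scope ereal_scope.

Definition edom phi : set 'cV[R]_d := [set x | phi x < +oo].

Definition proper_fun phi : Prop :=
  (forall x, phi x != -oo) /\ exists x, edom phi x.

Definition closed_fun phi : Prop :=
  closed [set p : 'cV[R]_d * R | phi p.1 <= p.2%:E].

(* With 0 * +oo = 0 the end points t = 0 and t = 1 are harmless. *)
Definition convex_efun phi : Prop :=
  forall (x y : 'cV[R]_d) (t : R), (0 <= t <= 1)%R ->
    phi (t *: x + (1 - t) *: y)%R <= t%:E * phi x + (1 - t)%:E * phi y.

End ExtendedFunctions.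

(* Matrices with d rows and any number of columns, with the topology of the
   disjoint union over the number of columns. *)
Definition sketch_mx (R : realType) (d : nat) := {n : nat & 'M[R]_(d, n)}.

HB.instance Definition _ (R : realType) (d : nat) :=
  Topological.copy (sketch_mx R d) {n : nat & 'M[R]_(d, n)}.
HB.instance Definition _ (R : realType) (d : nat) :=
  isPointed.Build (sketch_mx R d) (existT (fun n => 'M[R]_(d, n)) 0%N 0).

Definition borel (T : ptopologicalType) := g_sigma_algebraType (@open T).

HB.instance Definition _ (T : ptopologicalType) :=
  Measurable.copy (borel T) (g_sigma_algebraType (@open T)).

Section Sketches.
Context {R : realType} {d : nat}.
Implicit Types S : sketch_mx R d.

Definition ncols S : nat := projT1 S.

Definition mat S : 'M[R]_(d, ncols S) := projT2 S.

Definition full_col_rank S : Prop := \rank (mat S) = ncols S.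

Definition proj_range S : 'M[R]_d :=
  mat S *m invmx ((mat S)^T *m mat S) *m (mat S)^T.

(* A distribution determines its set of values only up to a null set: V is
   any set of full-column-rank matrices carrying D.  In particular V can be
   the set of values of a random matrix with law D, or the support of D,
   restricted to full-column-rank matrices. *)
Definition is_range (D : probability (borel (sketch_mx R d)) R)
    (V : set (sketch_mx R d)) : Prop :=
  (forall S, V S -> full_col_rank S) /\ {ae D, forall S, V S}.

Definition separable_set (V : set (sketch_mx R d)) (Q : set 'cV[R]_d) : Prop :=
  forall x y S, Q x -> Q y -> V S ->
    Q (proj_range S *m x + (1%:M - proj_range S) *m y).

(* The map phi' is only constrained on the domain of phi. *)
Definition separable_fun (V : set (sketch_mx R d)) (phi : 'cV[R]_d -> \bar R) :
    Prop :=
  separable_set V (edom phi) /\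
  exists phi' : 'cV[R]_d -> 'cV[R]_d,
    (forall x, edom phi x -> phi x = (dotp (phi' x) (const_mx 1))%:E) /\
    (forall x y S, edom phi x -> edom phi y -> V S ->
      phi' (proj_range S *m x + (1%:M - proj_range S) *m y) =
      proj_range S *m phi' x + (1%:M - proj_range S) *m phi' y).

End Sketches.

Section SSCN.
Context {R : realType} {d : nat}.
Variables (f : 'cV[R]_d -> R) (psi : 'cV[R]_d -> \bar R).

Definition objective (x : 'cV[R]_d) : \bar R := ((f x)%:E + psi x)%E.

Section Subspace.
Variables (n : nat) (S : 'M[R]_(d, n)).

Definition subspace_gradient (x : 'cV[R]_d) : 'cV[R]_n :=
  S^T *m gradient f x.

Definition subspace_hessian (x : 'cV[R]_d) : 'M[R]_n :=
  S^T *m hessian f x *m S.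

(* A supremum, equal to the maximum when the latter exists; it is 0 when
   n = 0. *)
Definition subspace_lipschitz : R :=
  sup [set r | exists (x : 'cV[R]_d) (h : 'cV[R]_n), h != 0 /\
    r = `|third_derivative f x (S *m h)| / enorm (S *m h) ^+ 3].

Definition cubic_model (x : 'cV[R]_d) (h : 'cV[R]_n) : \bar R :=
  ((dotp (subspace_gradient x) h
    + 2^-1 * dotp (subspace_hessian x *m h) h
    + subspace_lipschitz / 6 * enorm (S *m h) ^+ 3)%:E
   + psi (x + S *m h)%R)%E.

End Subspace.

Definition sscn_step (S : sketch_mx R d) (x y : 'cV[R]_d) : Prop :=
  exists2 h : 'cV[R]_(ncols S),
    (forall h', (cubic_model (mat S) x h <= cubic_model (mat S) x h')%E)
    & y = x + mat S *m h.

Section Process.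
Context {dO : measure_display} {Omega : measurableType dO}.
Variable P : probability Omega R.
Variable S : nat -> {RV P >-> borel (sketch_mx R d)}.
Variable x : nat -> {RV P >-> borel 'cV[R]_d}.

(* The sigma-algebra generated by x^0, ..., x^k and S_0, ..., S_(k-1). *)
Definition past (k : nat) : set (set Omega) :=
  <<s (\bigcup_(j in `I_k.+1) preimage_set_system setT (x j) measurable)
      `|` (\bigcup_(j in `I_k) preimage_set_system setT (S j) measurable) >>.

Definition is_sscn (D : probability (borel (sketch_mx R d)) R) (x0 : 'cV[R]_d) :
    Prop :=
  [/\ forall w, x 0%N w = x0,
      forall k A, measurable A -> distribution P (S k) A = D A,
      forall k A B, past k A -> measurable B ->
        P (A `&` S k @^-1` B) = (P A * P (S k @^-1` B))%E
    & forall k, {ae P, forall w, sscn_step (S k w) (x k w) (x k.+1 w)}].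

End Process.

End SSCN.

Definition level_radius {R : realType} {d : nat} (F : 'cV[R]_d -> \bar R)
    (x0 xstar : 'cV[R]_d) : R :=
  sup [set enorm (x - xstar) | x in [set x | (F x <= F x0)%E]].

(* Main.v *)
Require Import Defs.
From HB Require Import structures.
From mathcomp Require Import all_boot all_order all_algebra.
From mathcomp Require Import all_classical all_reals all_analysis.
From mathcomp Require Import measurable_realfun.
From mathcomp Require Import ring lra.

Set Implicit Arguments.
Unset Strict Implicit.
Unset Printing Implicit Defensive.
Import Order.TTheory GRing.Theory Num.Theory.
Import numFieldNormedType.Exports.
Local Open Scope classical_set_scope.
Local Open Scope ring_scope.

(** Write [P] for the projection [proj_range S], [p] for [tau / d], and let [g]
    and [H] be the gradient and the Hessian of [f] at [x].  Testing the cubic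
    model at the [h] with [S h = P v], where [v = b (xstar - x)], bounds the next
    objective value by the surrogate
      [f x + <g, P v> + 1/2 <H P v, P v> + M/6 |P v|^3 + psi (x + P v)].
    For fixed [x] this is at most an affine function of [P]: separability makes
    [psi (x + P v)] affine, [|P v|^3 <= |v| <P v, v>], and the quadratic term is
    expanded around the mean [p v] of [P v], whose variance is
    [p (1 - p) |v|^2].  Taking expectations and using convexity together with the
    quadratic growth [mu/2 |x - xstar|^2 <= F x - F xstar], the expected gap is
    multiplied at each step by at most [1 - p b / 2], with
    [b = 1 / (1 + 4 (1 - p) L / mu + 2 sqrt (M Rad / mu))].

    The map [psi'] need not be measurable, so independence is used through
    Tonelli's theorem applied to the surrogate itself, which is jointly
    measurable in [x] and [S] and dominates [F xstar] everywhere; [psi'] only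
    occurs for a fixed [x], inside the integral over [S]. *)

(** * Euclidean geometry and projections *)

Section InnerProduct.
Context {R : realType}.
Implicit Types (n : nat) (a : R).

Lemma dotpE n (u v : 'cV[R]_n) : dotp u v = (u^T *m v) ord0 ord0.
Proof. by rewrite mxE; apply: eq_bigr => i _; rewrite mxE. Qed.

Lemma dotpC n (u v : 'cV[R]_n) : dotp u v = dotp v u.
Proof. by apply: eq_bigr => i _; rewrite mulrC. Qed.

Lemma dotpDl n (u v w : 'cV[R]_n) : dotp (u + v) w = dotp u w + dotp v w.
Proof. by rewrite -big_split; apply: eq_bigr => i _; rewrite mxE mulrDl. Qed.

Lemma dotpZl n a (u v : 'cV[R]_n) : dotp (a *: u) v = a * dotp u v.
Proof. by rewrite /dotp mulr_sumr; apply: eq_bigr => i _; rewrite mxE mulrA. Qed.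

Lemma dotpDr n (u v w : 'cV[R]_n) : dotp w (u + v) = dotp w u + dotp w v.
Proof. by rewrite dotpC dotpDl !(dotpC w). Qed.

Lemma dotpZr n a (u v : 'cV[R]_n) : dotp u (a *: v) = a * dotp u v.
Proof. by rewrite dotpC dotpZl dotpC. Qed.

Lemma dotpNl n (u v : 'cV[R]_n) : dotp (- u) v = - dotp u v.
Proof. by rewrite -scaleN1r dotpZl mulN1r. Qed.

Lemma dotpNr n (u v : 'cV[R]_n) : dotp u (- v) = - dotp u v.
Proof. by rewrite dotpC dotpNl dotpC. Qed.

Lemma dotp0l n (u : 'cV[R]_n) : dotp 0 u = 0.
Proof. by rewrite -(scale0r u) dotpZl mul0r. Qed.

Lemma dotp_mulmx m n (A : 'M[R]_(m, n)) (u : 'cV[R]_n) (v : 'cV[R]_m) :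
  dotp (A *m u) v = dotp u (A^T *m v).
Proof. by rewrite !dotpE trmx_mul mulmxA. Qed.

Lemma dotp_ge0 n (u : 'cV[R]_n) : 0 <= dotp u u.
Proof. by apply: sumr_ge0 => i _; rewrite -expr2 sqr_ge0. Qed.

Lemma dotp_eq0 n (u : 'cV[R]_n) : dotp u u = 0 -> u = 0.
Proof.
move/eqP; rewrite psumr_eq0 => [/allP u0|i _]; last by rewrite -expr2 sqr_ge0.
apply/matrixP => i j; rewrite ord1 mxE.
have /eqP := u0 i (mem_index_enum _).
by rewrite -expr2 => /eqP; rewrite sqrf_eq0 => /eqP.
Qed.

Lemma enorm_ge0 n (u : 'cV[R]_n) : 0 <= enorm u.
Proof. exact: sqrtr_ge0. Qed.

Lemma sqr_enorm n (u : 'cV[R]_n) : enorm u ^+ 2 = dotp u u.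
Proof. by rewrite sqr_sqrtr // dotp_ge0. Qed.

Lemma enorm_gt0 n (u : 'cV[R]_n) : u != 0 -> 0 < enorm u.
Proof.
move=> u0; rewrite sqrtr_gt0 lt_neqAle dotp_ge0 andbT eq_sym.
by apply: contra u0 => /eqP/dotp_eq0 ->.
Qed.

Lemma enorm0 n : enorm (0 : 'cV[R]_n) = 0.
Proof. by rewrite /enorm dotp0l sqrtr0. Qed.

Lemma enormZ n a (u : 'cV[R]_n) : enorm (a *: u) = `|a| * enorm u.
Proof.
by rewrite /enorm dotpZl dotpZr mulrA -expr2 sqrtrM ?sqr_ge0// sqrtr_sqr.
Qed.

(** Cauchy-Schwarz: the squared norm of [dotp v v *: u - dotp u v *: v] is [dotp v v] times the
    difference of the two squared sides. *)
Lemma ler_dotp n (u v : 'cV[R]_n) : `|dotp u v| <= enorm u * enorm v.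
Proof.
rewrite -(@ler_pXn2r _ 2) ?nnegrE ?mulr_ge0 ?enorm_ge0// exprMn !sqr_enorm.
rewrite real_normK ?num_real//.
have [v0|v0] := eqVneq (dotp v v) 0.
  by rewrite v0 (dotp_eq0 v0) dotpC dotp0l expr0n mulr0.
have vp : 0 < dotp v v by rewrite lt_neqAle eq_sym v0 dotp_ge0.
have := dotp_ge0 (dotp v v *: u - dotp u v *: v).
rewrite !(dotpDl, dotpDr, dotpNl, dotpNr, dotpZl, dotpZr) (dotpC v u).
rewrite (_ : _ + _ = dotp v v * (dotp u u * dotp v v - dotp u v ^+ 2)); last by ring.
by rewrite pmulr_rge0// subr_ge0.
Qed.

Lemma psd_le n (A B : 'M[R]_n) (h : 'cV[R]_n) :
  loewner_le A B -> dotp (A *m h) h <= dotp (B *m h) h.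
Proof. by move/(_ h); rewrite mulmxBl dotpDl dotpNl subr_ge0. Qed.

Lemma dotp_scalar n a (h : 'cV[R]_n) : dotp (a%:M *m h) h = a * dotp h h.
Proof. by rewrite mul_scalar_mx dotpZl. Qed.

End InnerProduct.

Section Projection.
Context {R : realType} {d : nat}.
Implicit Type S : sketch_mx R d.

(** A row vector [u] killed by the Gram matrix satisfies [|S u^T|^2 = 0], and full column rank then
    forces [u = 0]. *)
Lemma gram_unitmx n (S : 'M[R]_(d, n)) : \rank S = n -> S^T *m S \in unitmx.
Proof.
move=> rS; rewrite -row_free_unit; apply: inj_row_free => u uSS.
have : dotp (S *m u^T) (S *m u^T) = 0.
  by rewrite dotpE trmx_mul trmxK mulmxA -(mulmxA u) uSS mul0mx mxE.
move/dotp_eq0/(congr1 trmx); rewrite trmx_mul trmxK trmx0 => /eqP.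
by rewrite mulmx_free_eq0 => [/eqP//|]; rewrite /row_free mxrank_tr rS.
Qed.

Lemma proj_range_tr S : (proj_range S)^T = proj_range S.
Proof.
by rewrite /proj_range !trmx_mul trmxK trmx_inv trmx_mul trmxK mulmxA.
Qed.

Lemma proj_range_idem S :
  full_col_rank S -> proj_range S *m proj_range S = proj_range S.
Proof.
move=> /gram_unitmx SS; rewrite {1}/proj_range /proj_range -!mulmxA.
by rewrite [_^T *m (mat S *m _)]mulmxA (mulmxA (invmx _)) mulVmx// mul1mx.
Qed.

Lemma proj_range_dotp S (v : 'cV[R]_d) : full_col_rank S ->
  dotp (proj_range S *m v) (proj_range S *m v) = dotp (proj_range S *m v) v.
Proof.
by move=> rS; rewrite dotp_mulmx proj_range_tr mulmxA proj_range_idem// dotpC.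
Qed.

Lemma proj_range_dotp_le S (v : 'cV[R]_d) : full_col_rank S ->
  dotp (proj_range S *m v) v <= dotp v v.
Proof.
move=> rS; have := dotp_ge0 (v - proj_range S *m v).
rewrite !(dotpDl, dotpDr, dotpNl, dotpNr) proj_range_dotp// (dotpC v).
lra.
Qed.

Lemma proj_range_enorm_le S (v : 'cV[R]_d) : full_col_rank S ->
  enorm (proj_range S *m v) <= enorm v.
Proof. by move=> rS; rewrite ler_wsqrtr// proj_range_dotp// proj_range_dotp_le. Qed.

(** Symmetry and idempotence give [P i i = \sum_k P i k ^+ 2], so every squared entry of row [i] is
    at most [P i i]; on the diagonal this yields [P i i <= 1]. The uniform bound makes the entries
    integrable. *)
Lemma proj_range_coef_le1 S i j : full_col_rank S -> `|proj_range S i j| <= 1.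
Proof.
move=> rS; set P := proj_range S.
have Psym k : P k i = P i k 
  by have /matrixP/(_ k i) := proj_range_tr S; rewrite mxE => /esym.
have Pii : P i i = \sum_k P i k ^+ 2.
  have -> : P i i = (P *m P) i i by rewrite proj_range_idem.
  by rewrite mxE; apply: eq_bigr => k _; rewrite Psym.
have Pij k : P i k ^+ 2 <= P i i.
  by rewrite [leRHS]Pii (bigD1 k)//= lerDl sumr_ge0// => l _; exact: sqr_ge0.
have Pii1 : P i i <= 1.
  by have := Pij i; nra.
by rewrite -(@ler_pXn2r _ 2) ?nnegrE// real_normK ?num_real// expr1n (le_trans (Pij j)).
Qed.

End Projection.

(** * Taylor bounds *)

Section Taylor.
Context {R : realType}.
Implicit Types (g dg : R -> R) (t : R).

Lemma is_derive_continuous g dg : (forall t, is_derive t 1 g (dg t)) ->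
  continuous g.
Proof.
by move=> gd t; apply/differentiable_continuous/derivable1_diffP; have [] := gd t.
Qed.

Lemma is_derive_le0 g dg : (forall t, is_derive t 1 g (dg t)) ->
  g 0 <= 0 -> (forall t, 0 <= t -> dg t <= 0) -> forall t, 0 <= t -> g t <= 0.
Proof.
move=> gd g0 dg0 t t0; apply: le_trans g0.
apply: (@ler0_derive1_nincr _ g 0 t) => //.
- move=> x; rewrite in_itv/= => /andP[x0 _].
  by rewrite derive1E; have [_ ->] := gd x; apply: dg0; exact: ltW.
- by apply: continuous_subspaceT; exact: is_derive_continuous gd.
Qed.

(** [h1] and [h0] are the remainders of [g1] and [g0] after the expansion at [0] with top
    coefficient [K]. Both vanish at [0] and [h1] is the derivative of [h0], so the sign of [g2 - K]
    passes to [h1], then to [h0]. *)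
Lemma taylor2_le (g0 g1 g2 : R -> R) (K : R) :
  (forall t, is_derive t 1 g0 (g1 t)) -> (forall t, is_derive t 1 g1 (g2 t)) ->
  (forall t, g2 t <= K) -> g0 1 <= g0 0 + g1 0 + K / 2.
Proof.
move=> d0 d1 g2K.
pose h1 t := g1 t - g1 0 - K * t.
pose h0 t := g0 t - g0 0 - g1 0 * t - K / 2 * t ^+ 2.
have dh1 t : is_derive t 1 h1 (g2 t - K).
  by apply: is_derive_eq; rewrite subr0 scaler1.
have dh0 t : is_derive t 1 h0 (h1 t).
  apply: is_derive_eq; rewrite /h1 /GRing.scale/=.
  by field.
have h1le t : 0 <= t -> h1 t <= 0.
  apply: (is_derive_le0 dh1); first by rewrite /h1; lra.
  by move=> s _; rewrite subr_le0.
have : h0 1 <= 0 by apply: (is_derive_le0 dh0) => //; rewrite /h0; lra.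
by rewrite /h0 expr1n; lra.
Qed.

(** The same cascade of remainders, one order higher. *)
Lemma taylor3_le (g0 g1 g2 g3 : R -> R) (K : R) :
  (forall t, is_derive t 1 g0 (g1 t)) -> (forall t, is_derive t 1 g1 (g2 t)) ->
  (forall t, is_derive t 1 g2 (g3 t)) -> (forall t, g3 t <= K) ->
  g0 1 <= g0 0 + g1 0 + g2 0 / 2 + K / 6.
Proof.
move=> d0 d1 d2 g3K.
pose h2 t := g2 t - g2 0 - K * t.
pose h1 t := g1 t - g1 0 - g2 0 * t - K / 2 * t ^+ 2.
pose h0 t := g0 t - g0 0 - g1 0 * t - g2 0 / 2 * t ^+ 2 - K / 6 * t ^+ 3.
have dh2 t : is_derive t 1 h2 (g3 t - K).
  by apply: is_derive_eq; rewrite subr0 scaler1.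
have dh1 t : is_derive t 1 h1 (h2 t).
  apply: is_derive_eq; rewrite /h2 /GRing.scale/=.
  by field.
have dh0 t : is_derive t 1 h0 (h1 t).
  apply: is_derive_eq; rewrite /h1 /GRing.scale/=.
  by field.
have h2le t : 0 <= t -> h2 t <= 0.
  apply: (is_derive_le0 dh2); first by rewrite /h2; lra.
  by move=> s _; rewrite subr_le0.
have h1le t : 0 <= t -> h1 t <= 0.
  by apply: (is_derive_le0 dh1) => //; rewrite /h1 expr0n/=; lra.
have : h0 1 <= 0.
  by apply: (is_derive_le0 dh0) => //; rewrite /h0 !expr0n/=; lra.
by rewrite /h0 !expr1n; lra.
Qed.

(** The difference quotients are bounded by [K], and the bound survives the limit. This turns the
    Lipschitz constant of the Hessian into a bound on the third derivative. *)
Lemma is_derive_lipschitz g (t l K : R) : is_derive t 1 g l ->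
  (forall s, `|g s - g t| <= K * `|s - t|) -> `|l| <= K.
Proof.
move=> [gd <-] gK; move: gd => /cvg_norm/= gd.
rewrite /derive; have/= <- := cvg_lim (@norm_hausdorff _ _) gd.
apply: limr_le; first by apply/cvg_ex; eexists; exact: gd.
near=> h.
have h0 : h != 0 by near: h; exact: nbhs_dnbhs_neq.
rewrite normrM normfV mulrC ler_pdivrMr ?normr_gt0//.
by rewrite (le_trans (gK _))// addrK scaler1.
Unshelve. all: by end_near. Qed.

End Taylor.

(** * Derivatives of [f] along lines and the resulting Taylor bounds *)

Section Lines.
Context {R : realType} {d : nat}.
Implicit Types (f : 'cV[R]_d -> R) (x y v : 'cV[R]_d) (s t : R).

Lemma is_derive_line (W : normedModType R) (g : 'cV[R]_d -> W) x v t :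
  differentiable g (x + t *: v) ->
  is_derive t 1 (fun s => g (x + s *: v)) ('D_v g (x + t *: v)).
Proof.
move=> /(@diff_derivable _ _ _ _ _ v) gd.
(* The two difference quotients coincide pointwise, so derivability and the derivative transfer
   together. *)
have e : (fun h : R => h^-1 *: (((fun s => g (x + s *: v)) \o shift t) (h *: 1)
            - g (x + t *: v))) =
    (fun h => h^-1 *: ((g \o shift (x + t *: v)) (h *: v) - g (x + t *: v))).
  apply/funext => h /=; congr (_ *: (g _ - _)).
  by rewrite [_%:A]mulr1 scalerDl addrCA.
by apply: DeriveDef; rewrite /derivable /derive e.
Qed.

(** Linearity of the differential: the coordinatewise [gradient] and [hessian] thus determine the
    derivatives in all directions. *)
Lemma derive_basis (W : normedModType R) (g : 'cV[R]_d -> W) x v :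
  differentiable g x -> 'D_v g x = \sum_i v i ord0 *: 'D_(delta_mx i ord0) g x.
Proof.
move=> gd; rewrite deriveE//.
have {1}-> : v = \sum_i v i ord0 *: delta_mx i ord0.
  by rewrite {1}[v]matrix_sum_delta; apply: eq_bigr => i _; rewrite big_ord1.
rewrite linear_sum; apply: eq_bigr => i _.
by rewrite linearZ deriveE.
Qed.

Lemma derive_gradient f x v : differentiable f x ->
  'D_v f x = dotp (gradient f x) v.
Proof.
by move=> /derive_basis ->; apply: eq_bigr => i _; rewrite mxE mulrC.
Qed.

Lemma derive_hessian f x v : differentiable (gradient f) x ->
  'D_v (gradient f) x = hessian f x *m v.
Proof.
move=> gd; rewrite derive_basis//; apply/matrixP => i j; rewrite (ord1 j) summxE mxE.
apply: eq_bigr => k _; rewrite !mxE mulrC derive_mx ?mxE//; last exact: diff_derivable.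
Qed.

Lemma is_derive_dotp n (G : R -> 'cV[R]_n) (dG u : 'cV[R]_n) (t : R) :
  is_derive t 1 G dG -> is_derive t 1 (fun s => dotp (G s) u) (dotp dG u).
Proof.
move=> [Gd <-].
have -> : (fun s => dotp (G s) u) = \sum_i (fun s => u i ord0 *: G s i ord0).
  by apply/funext => s; rewrite fct_sumE; apply: eq_bigr => i _; rewrite mulrC.
have -> : dotp ('D_1 G t) u = \sum_i u i ord0 *: 'D_1 (fun s => G s i ord0) t.
  by apply: eq_bigr => i _; rewrite mulrC derive_mx// mxE.
apply: is_derive_sum => i; apply: is_deriveZ; apply: derivableP.
by move/derivable_mxP : Gd; exact.
Qed.

Lemma is_derive_mulmx m n (G : R -> 'M[R]_(m, n)) (dG : 'M[R]_(m, n))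
    (u : 'cV[R]_n) (t : R) :
  is_derive t 1 G dG -> is_derive t 1 (fun s => G s *m u) (dG *m u).
Proof.
move=> [Gd <-]; have Gdij := (derivable_mxP _ _ _).1 Gd.
have dij i : is_derive t 1 (fun s => (G s *m u) i ord0) (('D_1 G t *m u) i ord0).
  have -> : (fun s => (G s *m u) i ord0) = \sum_j (fun s => u j ord0 *: G s i j).
    apply/funext => s; rewrite fct_sumE mxE; apply: eq_bigr => j _.
    by rewrite mulrC.
  have -> : ('D_1 G t *m u) i ord0 =
      \sum_j u j ord0 *: 'D_1 (fun s => G s i j) t.
    by rewrite mxE; apply: eq_bigr => j _; rewrite mulrC derive_mx// mxE.
  by apply: is_derive_sum => j; apply: is_deriveZ; apply: derivableP.
have Gu : derivable (fun s => G s *m u) t 1.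
  by apply/derivable_mxP => i j; rewrite ord1; have [] := dij i.
apply: (DeriveDef Gu); rewrite derive_mx//; apply/matrixP => i j.
by rewrite ord1 mxE; have [_ ->] := dij i.
Qed.

Section Smooth.
Variable f : 'cV[R]_d -> R.
Hypothesis f3 : three_times_differentiable f.

Lemma is_derive_line1 x v t :
  is_derive t 1 (fun s => f (x + s *: v)) (dotp (gradient f (x + t *: v)) v).
Proof.
have [fd _ _] := f3; rewrite -derive_gradient//; exact: is_derive_line.
Qed.

Lemma is_derive_line2 x v t :
  is_derive t 1 (fun s => dotp (gradient f (x + s *: v)) v)
    (dotp (hessian f (x + t *: v) *m v) v).
Proof.
have [_ gd _] := f3.
have := is_derive_line (gd (x + t *: v)); rewrite derive_hessian//.
exact: (@is_derive_dotp _ (fun s => gradient f (x + s *: v))).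
Qed.

Lemma is_derive_line3 x v t :
  is_derive t 1 (fun s => dotp (hessian f (x + s *: v) *m v) v)
    (third_derivative f (x + t *: v) v).
Proof.
have [_ _ hd] := f3; have := is_derive_line (hd (x + t *: v)).
move=> /(@is_derive_mulmx _ _ (fun s => hessian f (x + s *: v)) _ v).
exact: (@is_derive_dotp _ (fun s => hessian f (x + s *: v) *m v)).
Qed.

Lemma cubic_upper_bound x v K : (forall y, third_derivative f y v <= K) ->
  f (x + v) <=
  f x + dotp (gradient f x) v + dotp (hessian f x *m v) v / 2 + K / 6.
Proof.
move=> fK; have := taylor3_le (is_derive_line1 x v) (is_derive_line2 x v)
  (is_derive_line3 x v) (fun t => fK _).
by rewrite scale1r scale0r addr0.
Qed.

(** Serves to apply the upper Taylor bounds to [- f], which gives the lower ones. *)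
Lemma is_derive_oppf (g : R -> R) (l t : R) :
  is_derive t 1 g l -> is_derive t 1 (fun s => - g s) (- l).
Proof. by move=> ?; apply: is_deriveN. Qed.

Lemma cubic_lower_bound x v K : (forall y, - K <= third_derivative f y v) ->
  f x + dotp (gradient f x) v + dotp (hessian f x *m v) v / 2 - K / 6 <=
  f (x + v).
Proof.
move=> fK.
have fK' t : - third_derivative f (x + t *: v) v <= K by rewrite lerNl.
have := taylor3_le (fun t => is_derive_oppf (is_derive_line1 x v t))
  (fun t => is_derive_oppf (is_derive_line2 x v t))
  (fun t => is_derive_oppf (is_derive_line3 x v t)) fK'.
rewrite scale1r scale0r addr0; lra.
Qed.

Lemma strong_convexity_gradient mu x v :
  (forall y, loewner_le mu%:M (hessian f y)) ->
  f x + dotp (gradient f x) v + mu / 2 * dotp v v <= f (x + v).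
Proof.
move=> muf.
have muf' t : - dotp (hessian f (x + t *: v) *m v) v <= - (mu * dotp v v).
  by rewrite lerN2 -dotp_scalar psd_le.
have := taylor2_le (fun t => is_derive_oppf (is_derive_line1 x v t))
  (fun t => is_derive_oppf (is_derive_line2 x v t)) muf'.
rewrite scale1r scale0r addr0; lra.
Qed.

(** The gradient inequality at [z] is applied towards [x] and towards [y]; with weights [t] and
    [1 - t] the gradient terms cancel. *)
Lemma strong_convexity mu x y t :
  (forall y, loewner_le mu%:M (hessian f y)) -> 0 <= t <= 1 ->
  f (t *: x + (1 - t) *: y) <=
  t * f x + (1 - t) * f y - mu / 2 * (t * (1 - t)) * dotp (x - y) (x - y).
Proof.
move=> muf /andP[t0 t1]; set z := _ + _.
have xz : x = z + (1 - t) *: (x - y).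
  by rewrite /z; apply/matrixP => i j; rewrite !mxE; ring.
have yz : y = z + (- t) *: (x - y).
  by rewrite /z; apply/matrixP => i j; rewrite !mxE; ring.
have := strong_convexity_gradient z ((1 - t) *: (x - y)) muf.
have := strong_convexity_gradient z ((- t) *: (x - y)) muf.
rewrite -xz -yz !(dotpZr, dotpZl); set g := dotp _ (x - y); set D := dotp _ _.
move=> fy fx; have := ler_wpM2l t0 fx.
have : (1 - t) * (f z + - t * g + mu / 2 * (- t * (- t * D))) <= (1 - t) * f y.
  by rewrite ler_wpM2l// subr_ge0.
nra.
Qed.

Variable M : R.
Hypothesis fM : lipschitz_hessian M f.

(** By Cauchy-Schwarz, [<H(y + s v) v, v>] differs from its value at [s = 0] by at most
    [M |v|^3 |s|], and its derivative there is the third derivative. *)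
Lemma third_derivative_le y v : `|third_derivative f y v| <= M * enorm v ^+ 3.
Proof.
have := is_derive_line3 y v 0; rewrite scale0r addr0 => /is_derive_lipschitz; apply.
move=> s; rewrite scale0r addr0 -dotpNl -dotpDl -mulmxBl.
apply: (le_trans (ler_dotp _ _)).
apply: (le_trans (ler_wpM2r (enorm_ge0 _) (fM _ _ _))).
rewrite addrAC subrr add0r enormZ subr0.
by rewrite le_eqVlt; apply/orP; left; apply/eqP; ring.
Qed.

(** A nonzero vector is needed to test the Lipschitz bound: in dimension [0] the bound holds for
    every [M]. *)
Lemma lipschitz_hessian_ge0 : (0 < d)%N -> 0 <= M.
Proof.
move=> d0; have [y y0] : exists y : 'cV[R]_d, y != 0.
  exists (const_mx 1); apply/eqP => /matrixP/(_ (Ordinal d0) ord0)/eqP.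
  by rewrite !mxE oner_eq0.
have := fM y 0 y; rewrite subr0 => /(le_trans (enorm_ge0 _)).
by rewrite !pmulr_lge0// enorm_gt0.
Qed.

Variables (n : nat) (S : 'M[R]_(d, n)).
Hypothesis rS : \rank S = n.

Lemma full_rank_mulmx_neq0 (h : 'cV[R]_n) : h != 0 -> S *m h != 0.
Proof.
apply: contra => /eqP Sh; have := mulmxA (invmx (S^T *m S)) (S^T *m S) h.
by rewrite mulVmx ?gram_unitmx// mul1mx -mulmxA Sh !mulmx0 => <-.
Qed.

Lemma subspace_third_derivative_ubound : ubound [set r | exists x (h : 'cV[R]_n),
  h != 0 /\ r = `|third_derivative f x (S *m h)| / enorm (S *m h) ^+ 3] M.
Proof.
move=> _ [x [h [h0 ->]]]; rewrite ler_pdivrMr ?third_derivative_le//.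
by rewrite exprn_gt0// enorm_gt0// full_rank_mulmx_neq0.
Qed.

Lemma subspace_lipschitz_le : (0 < d)%N -> subspace_lipschitz f S <= M.
Proof.
move=> d0; have [[r Er]|E0] := pselect (exists r, [set r | exists x (h : 'cV[R]_n),
    h != 0 /\ r = `|third_derivative f x (S *m h)| / enorm (S *m h) ^+ 3] r).
  by apply: ge_sup; [exists r|exact: subspace_third_derivative_ubound].
(* Without a nonzero [h] the set is empty and its supremum is [0], so the claim becomes [0 <= M]. *)
rewrite /subspace_lipschitz (_ : mkset _ = set0) ?sup0 ?lipschitz_hessian_ge0//.
by apply/seteqP; split => // r Er; case: E0; exists r.
Qed.

(** The supremum is an upper bound because the ratios are bounded by [M]; [h = 0], excluded from the
    set, makes both sides vanish. *)
Lemma le_subspace_lipschitz x (h : 'cV[R]_n) :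
  `|third_derivative f x (S *m h)| <= subspace_lipschitz f S * enorm (S *m h) ^+ 3.
Proof.
have [->|h0] := eqVneq h 0.
  by rewrite mulmx0 /third_derivative mulmx0 dotp0l normr0 enorm0 expr0n mulr0.
rewrite -ler_pdivrMr ?exprn_gt0 ?enorm_gt0 ?full_rank_mulmx_neq0//.
apply: ub_le_sup; last by exists x, h.
by exists M; exact: subspace_third_derivative_ubound.
Qed.

End Smooth.

End Lines.

(** * Borel measurability *)

Section Borel.
Context {R : realType}.

Lemma open_borel_measurable (T : ptopologicalType) (A : set T) :
  open A -> measurable (A : set (borel T)).
Proof. exact: sub_sigma_algebra. Qed.

Lemma closed_borel_measurable (T : ptopologicalType) (A : set T) :
  closed A -> measurable (A : set (borel T)).
Proof.
move=> cA; rewrite -[A]setCK; apply: measurableC.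
by apply: open_borel_measurable; exact: closed_openC.
Qed.

Lemma continuous_borel_measurable (T : ptopologicalType) (g : T -> R) :
  continuous g -> measurable_fun setT (g : borel T -> R).
Proof.
move=> /continuousP cg; apply: (measurability _ (RGenOpens.measurableE R)).
move=> _ [_ [a [b ->]] <-]; rewrite setTI; apply: open_borel_measurable.
by apply: cg; exact: interval_open.
Qed.

(** Matrix operations preserve measurability entry by entry; [measurable_borel_mx] turns it into
    Borel measurability. *)
Definition entrywise_measurable dT (T : measurableType dT) m n
    (Phi : T -> 'M[R]_(m, n)) : Prop :=
  forall i j, measurable_fun setT (fun t => Phi t i j).

Lemma entrywise_measurable_id m n :
  entrywise_measurable (fun A : borel 'M[R]_(m, n) => A).
Proof. by move=> i j; apply: continuous_borel_measurable; exact: coord_continuous. Qed.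

(** Second countability made explicit: the union runs over the countable type of pairs of rational
    matrices and keeps the boxes contained in [O]. *)
Lemma open_mx_boxes m n (O : set 'M[R]_(m, n)) : open O ->
  let box (q : 'M[rat]_(m, n) * 'M[rat]_(m, n)) :=
    [set A : 'M[R]_(m, n) | forall i j, ratr (q.1 i j) < A i j < ratr (q.2 i j)] in
  O = \bigcup_q (if `[< box q `<=` O >] then box q else set0).
Proof.
move=> oO box; apply/seteqP; split => [A OA|A [q _]]; last first.
  by case: asboolP => // qO; exact: qO.
have /nbhs_ballP[e /= e0 eO] : nbhs A O by exact: open_nbhs_nbhs.
(* Rational bounds within [e] on both sides of each entry enclose [A] in a box inside the ball,
   since balls of matrices are taken entrywise. *)
have ex i j : exists q : rat * rat,
    A i j - e < ratr q.1 < A i j /\ A i j < ratr q.2 < A i j + e.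
  have [q1] := @rat_in_itvoo R (A i j - e) (A i j) ltac:(by rewrite ltrBlDr ltrDl).
  have [q2] := @rat_in_itvoo R (A i j) (A i j + e) ltac:(by rewrite ltrDl).
  by rewrite !in_itv/= => h2 h1; exists (q1, q2).
pose q i j := sval (cid (ex i j)).
have qP i j : A i j - e < ratr (q i j).1 < A i j /\
              A i j < ratr (q i j).2 < A i j + e := svalP (cid (ex i j)).
exists (\matrix_(i, j) (q i j).1, \matrix_(i, j) (q i j).2) => //.
rewrite asboolT; last first.
  move=> B AB; apply: eO; split => // i j; have := AB i j; rewrite !mxE.
  have [/andP[h1 h2] /andP[h3 h4]] := qP i j.
  by rewrite /ball/= => /andP[h5 h6]; rewrite ltr_norml; lra.
by move=> i j; rewrite !mxE; have [/andP[_ ->] /andP[->]] := qP i j.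
Qed.

(** Open sets generate the Borel sets and are countable unions of boxes; the preimage of a box is a
    finite intersection of preimages of intervals. *)
Lemma measurable_borel_mx dT (T : measurableType dT) m n
    (Phi : T -> 'M[R]_(m, n)) :
  entrywise_measurable Phi ->
  measurable_fun setT (Phi : T -> borel 'M[R]_(m, n)).
Proof.
move=> mPhi; apply: (measurability _ (erefl : @measurable _ (borel 'M[R]_(m, n)) = _)).
move=> _ [U oU <-]; rewrite setTI (open_mx_boxes oU) preimage_bigcup.
apply: countable_bigcupT_measurable => // q.
case: asboolP => _; last by rewrite preimage_set0.
rewrite (_ : _ @^-1` _ = \bigcap_(i in [set: 'I_m]) \bigcap_(j in [set: 'I_n])
    ((fun t => Phi t i j) @^-1` `]ratr (q.1 i j), ratr (q.2 i j)[)); last first.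
  apply/seteqP; split => t /= H i; first by move=> _ j _ /=; rewrite in_itv/=; exact: H.
  by move=> j; have := H i I j I; rewrite /= in_itv.
apply: fin_bigcap_measurable => // i _; apply: fin_bigcap_measurable => // j _.
by rewrite -[X in measurable X]setTI; apply: mPhi.
Qed.

Section EntrywiseMeasurable.
Context dT (T : measurableType dT).

Lemma entrywise_measurable_comp m n (Phi : T -> borel 'M[R]_(m, n)) :
  measurable_fun setT Phi -> entrywise_measurable Phi.
Proof. by move=> mPhi i j; exact: measurableT_comp (entrywise_measurable_id i j) _. Qed.

Lemma entrywise_measurableD m n (Phi Psi : T -> 'M[R]_(m, n)) :
  entrywise_measurable Phi -> entrywise_measurable Psi ->
  entrywise_measurable (fun t => Phi t + Psi t).
Proof.
move=> mPhi mPsi i j; under eq_fun do rewrite mxE.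
exact: measurable_funD.
Qed.

Lemma entrywise_measurableZ m n (g : T -> R) (Phi : T -> 'M[R]_(m, n)) :
  measurable_fun setT g -> entrywise_measurable Phi ->
  entrywise_measurable (fun t => g t *: Phi t).
Proof.
move=> mg mPhi i j; under eq_fun do rewrite mxE.
exact: measurable_funM.
Qed.

Lemma entrywise_measurableM m n p (Phi : T -> 'M[R]_(m, n))
    (Psi : T -> 'M[R]_(n, p)) :
  entrywise_measurable Phi -> entrywise_measurable Psi ->
  entrywise_measurable (fun t => Phi t *m Psi t).
Proof.
move=> mPhi mPsi i j; under eq_fun do rewrite mxE.
by apply: measurable_sum => k; exact: measurable_funM.
Qed.

Lemma entrywise_measurable_tr m n (Phi : T -> 'M[R]_(m, n)) :
  entrywise_measurable Phi -> entrywise_measurable (fun t => (Phi t)^T).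
Proof. by move=> mPhi i j; under eq_fun do rewrite mxE; exact: mPhi. Qed.

Lemma measurable_dotp n (u v : T -> 'cV[R]_n) : entrywise_measurable u ->
  entrywise_measurable v -> measurable_fun setT (fun t => dotp (u t) (v t)).
Proof.
by move=> mu mv; apply: measurable_sum => k; exact: measurable_funM.
Qed.

Lemma measurable_det n (Phi : T -> 'M[R]_n) : entrywise_measurable Phi ->
  measurable_fun setT (fun t => \det (Phi t)).
Proof.
move=> mPhi; apply: measurable_sum => s; apply: measurable_funM => //.
by apply: measurable_prod => i _; exact: mPhi.
Qed.

Lemma entrywise_measurable_adj n (Phi : T -> 'M[R]_n) :
  entrywise_measurable Phi -> entrywise_measurable (fun t => \adj (Phi t)).
Proof.
move=> mPhi i j; under eq_fun do rewrite mxE /cofactor.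
apply: measurable_funM => //; apply: measurable_det => k l.
by under eq_fun do rewrite !mxE; exact: mPhi.
Qed.

(** Inversion is continuous off [0], and the remaining point is a measurable piece by itself. *)
Lemma measurable_inv (g : T -> R) : measurable_fun setT g ->
  measurable_fun setT (fun t => (g t)^-1).
Proof.
apply: measurableT_comp.
have -> : [set: R] = [set~ 0] `|` [set 0] by rewrite setvU.
have o0 : open [set~ (0 : R)].
  apply: closed_openC.
  exact: accessible_closed_set1 (hausdorff_accessible (@norm_hausdorff _ _)) 0.
apply/measurable_funU; [exact: open_measurable|exact: measurable_set1|].
split; last exact: measurable_fun_set1.
apply: open_continuous_measurable_fun => // x; rewrite inE/= => /eqP x0.
exact: inv_continuous.
Qed.

Lemma entrywise_measurable_invmx n (Phi : T -> 'M[R]_n) :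
  entrywise_measurable Phi -> entrywise_measurable (fun t => invmx (Phi t)).
Proof.
move=> mPhi i j.
(* [invmx] is the cofactor formula on invertible matrices and leaves singular ones unchanged: two
   measurable pieces separated by the determinant. *)
have -> : (fun t => invmx (Phi t) i j) = (fun t => if \det (Phi t) != 0
    then (((\det (Phi t))^-1 *: \adj (Phi t)) i j) else Phi t i j).
  by apply/funext => t; rewrite /invmx unitmxE unitfE; case: ifP.
apply: measurable_fun_ifT => //.
  apply: (@measurable_fun_bool _ _ _ _ false).
  rewrite setTI [X in measurable X](_ : _ = (fun t => \det (Phi t)) @^-1` [set 0]).
    by rewrite -[X in measurable X]setTI; exact: (measurable_det mPhi).
  by apply/seteqP; split => t /=; [move/negbFE/eqP|move=> ->; rewrite eqxx].
by apply: entrywise_measurableZ; [exact/measurable_inv/measurable_det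
  |exact: entrywise_measurable_adj].
Qed.

End EntrywiseMeasurable.

(** * Borel sets and measurable maps on the space of sketches *)

Section Sketch.
Context {d : nat}.

(** The sets with measurable image form a sigma-algebra containing the open sets: since [E] is
    injective, a complement goes to the complement of the image inside the open component of
    [n]-column matrices. *)
Lemma existT_borel_measurable n (C : set 'M[R]_(d, n)) :
  measurable (C : set (borel 'M[R]_(d, n))) ->
  measurable (existT (fun n => 'M[R]_(d, n)) n @` C : set (borel (sketch_mx R d))).
Proof.
pose E := @existT nat (fun n => 'M[R]_(d, n)) n.
have inj : injective E.
  move=> A B /(congr1 (fun s => @tagged_as _ (fun n => 'M[R]_(d, n)) (E A) s)).
  by rewrite !tagged_asE.
move: C; apply: smallest_sub; last first.
  by move=> C oC; apply: open_borel_measurable; exact: existT_open_map.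
split.
- by rewrite /= image_set0.
- move=> C /= mC; rewrite (_ : _ @` _ = (E @` setT) `\` (E @` C)).
    apply: measurableD => //; apply: open_borel_measurable.
    by apply: existT_open_map; exact: openT.
  apply/seteqP; split => [_ [A [_ nCA] <-]|_ [[A _ <-] nCA]].
    by split; [exists A|case=> B CB /inj BA; apply: nCA; rewrite -BA].
  by exists A => //; split => // CA; apply: nCA; exists A.
- by move=> F mF; rewrite /= image_bigcup; exact: bigcupT_measurable.
Qed.

(** A preimage splits into countably many pieces, one for each number of columns. *)
Lemma sketch_measurable_fun (g : sketch_mx R d -> R) :
  (forall n, measurable_fun setT
     (fun A : borel 'M[R]_(d, n) => g (existT (fun n => 'M[R]_(d, n)) n A))) ->
  measurable_fun setT (g : borel (sketch_mx R d) -> R).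
Proof.
move=> mg _ B mB; rewrite setTI.
rewrite (_ : g @^-1` B = \bigcup_n (existT (fun n => 'M[R]_(d, n)) n @`
    [set A | B (g (existT (fun n => 'M[R]_(d, n)) n A))])).
  apply: bigcupT_measurable => n; apply: existT_borel_measurable.
  by have := mg n measurableT B mB; rewrite setTI.
by apply/seteqP; split => [[n A] BA|_ [n _ [A BA <-]]//]; exists n => //; exists A.
Qed.

Lemma proj_range_measurable :
  entrywise_measurable (fun S : borel (sketch_mx R d) => proj_range S).
Proof.
move=> i j; apply: sketch_measurable_fun => n.
have mid := @entrywise_measurable_id d n.
have mtr := entrywise_measurable_tr mid.
apply: entrywise_measurableM => //; apply: entrywise_measurableM => //.
by apply: entrywise_measurable_invmx; exact: entrywise_measurableM.
Qed.

(** Each sublevel set is a slice of the closed epigraph at a fixed height, hence closed. *)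
Lemma closed_fun_measurable (phi : 'cV[R]_d -> \bar R) : closed_fun phi ->
  measurable_fun setT (phi : borel 'cV[R]_d -> \bar R).
Proof.
move=> cphi; apply: (measurability _ (ErealGenOInfty.measurableE R)).
move=> _ [_ [r ->] <-]; rewrite setTI -[X in measurable X]setCK.
apply: measurableC; apply: closed_borel_measurable.
rewrite (_ : ~` _ =
    (fun x => (x, r)) @^-1` [set p : 'cV[R]_d * R | (phi p.1 <= p.2%:E)%E]).
  apply: closed_comp => // x _; exact: (cvg_pair (cvg_id (F := nbhs x)) (cvg_cst r)).
apply/seteqP; split => x /=; rewrite in_itv/= andbT.
  by move=> /negP; rewrite -leNgt.
by rewrite leNgt => /negP.
Qed.

End Sketch.

End Borel.

(** * One step of the method *)

Section OneStep.
Context {R : realType} {d : nat}.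
Variables (f : 'cV[R]_d -> R) (psi : 'cV[R]_d -> \bar R).
Implicit Types (x y u v : 'cV[R]_d) (S : sketch_mx R d).
Let F := objective f psi.

(** The cubic model in the full space, shifted by [f x], with the global constant [M] instead of the
    subspace one: a sketch enters only through the displacement [u]. *)
Definition cubic_surrogate (M : R) x u : \bar R :=
  ((f x + dotp (gradient f x) u + 2^-1 * dotp (hessian f x *m u) u
    + M / 6 * enorm u ^+ 3)%:E + psi (x + u)%R)%E.

Hypotheses (d_gt0 : (0 < d)%N) (f3 : three_times_differentiable f).
Variable M : R.
Hypothesis fM : lipschitz_hessian M f.

Lemma objective_le_surrogate x u : (F (x + u) <= cubic_surrogate M x u)%E.
Proof.
rewrite /F /objective /cubic_surrogate leeD2r// lee_fin.
have h y : third_derivative f y u <= M * enorm u ^+ 3.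
  by rewrite (le_trans (ler_norm _))// third_derivative_le.
by have := cubic_upper_bound f3 x h; lra.
Qed.

(** Along [S h] the third derivative is controlled by the subspace constant, so the Taylor bound
    holds with the constant of the model. *)
Lemma sscn_step_cubic_model n (S : 'M[R]_(d, n)) x h : \rank S = n ->
  (F (x + S *m h) <= (f x)%:E + cubic_model f psi S x h)%E.
Proof.
move=> rS; rewrite /F /objective /cubic_model addeA leeD2r//= lee_fin.
have hK y : third_derivative f y (S *m h) <=
    subspace_lipschitz f S * enorm (S *m h) ^+ 3.
  by rewrite (le_trans (ler_norm _))// (le_subspace_lipschitz f3 fM).
have := cubic_upper_bound f3 x hK.
rewrite /subspace_gradient /subspace_hessian -!mulmxA !(dotp_mulmx S^T) !trmxK.
lra.
Qed.

(** The minimizer of the model is compared with [h' = 0], where the model equals [psi x]. *)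
Lemma sscn_step_le S x y : full_col_rank S -> sscn_step f psi S x y ->
  (F y <= F x)%E.
Proof.
move=> rS [h hmin ->]; apply: (le_trans (sscn_step_cubic_model _ _ rS)).
rewrite /F /objective leeD2l//; apply: (le_trans (hmin 0)).
rewrite /cubic_model /subspace_hessian mulmx0 (dotp0l 0) mulmx0 enorm0 addr0.
by rewrite dotpC dotp0l expr0n !mulr0 !addr0 add0e.
Qed.

Lemma sscn_step_surrogate S x y v : full_col_rank S -> sscn_step f psi S x y ->
  (F y <= cubic_surrogate M x (proj_range S *m v))%E.
Proof.
move=> rS [h hmin ->]; apply: (le_trans (sscn_step_cubic_model _ _ rS)).
(* The least-squares coefficients of [v]: [S h'] is its projection onto the range of [S]. *)
pose h' := invmx ((mat S)^T *m mat S) *m (mat S)^T *m v.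
have Sh' : mat S *m h' = proj_range S *m v by rewrite /h' /proj_range !mulmxA.
rewrite -Sh'; move: h' {Sh'} => h'.
apply: (le_trans (leeD2l _ (hmin h'))).
rewrite /cubic_model /cubic_surrogate addeA leeD2r//= lee_fin.
rewrite /subspace_gradient /subspace_hessian -!mulmxA.
rewrite !(dotp_mulmx (mat S)^T) !trmxK !addrA lerD2l ler_wpM2r//.
  by rewrite exprn_ge0// enorm_ge0.
(* The subspace constant is at most [M]. *)
by rewrite ler_wpM2r// (subspace_lipschitz_le f3 fM rS).
Qed.

Hypothesis psi_proper : forall x, psi x != -oo%E.
Hypothesis psi_convex : convex_efun psi.
Variable mu : R.
Hypotheses (mu_gt0 : 0 < mu) (f_mu : forall y, loewner_le mu%:M (hessian f y)).

Lemma edom_objective x : edom F x <-> edom psi x.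
Proof.
rewrite /edom /F /objective /=; have := psi_proper x.
by case: (psi x) => // r _; rewrite !ltry.
Qed.

Lemma objective_strong_convexity x y (t : R) : edom F x -> edom F y ->
  0 <= t <= 1 ->
  (F (t *: x + (1 - t) *: y) <= (t * fine (F x) + (1 - t) * fine (F y)
    - mu / 2 * (t * (1 - t)) * dotp (x - y) (x - y))%:E)%E.
Proof.
move=> Fx Fy t01; have := psi_convex x y t01.
have := strong_convexity f3 x y f_mu t01.
move/edom_objective : Fx; move/edom_objective : Fy.
rewrite /edom /F /objective /=; have := psi_proper x; have := psi_proper y.
case: (psi y) => // b _; case: (psi x) => // a _ _ _ ft.
rewrite -!EFinM -EFinD/=; case: (psi _) => [c|//|_]; last by rewrite addeNy leNye.
rewrite -EFinD !lee_fin.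
by move=> ct; lra.
Qed.

Lemma edom_segment x y (t : R) : edom F x -> edom F y -> 0 <= t <= 1 ->
  edom F (x + t *: (y - x)).
Proof.
move=> Fx Fy t01; have := objective_strong_convexity Fy Fx t01.
have -> : x + t *: (y - x) = t *: y + (1 - t) *: x.
  by apply/matrixP => i j; rewrite !mxE; ring.
by move=> h; exact: le_lt_trans h (ltry _).
Qed.

Variable xstar : 'cV[R]_d.
Hypothesis xstar_min : forall y, (F xstar <= F y)%E.

Lemma edom_minimizer x : edom F x -> edom F xstar.
Proof. exact: le_lt_trans. Qed.

Lemma edom_fineK x : edom F x -> F x = (fine (F x))%:E.
Proof.
move=> Fx; rewrite fineK// fin_numElt Fx andbT.
by rewrite /F /objective; have := psi_proper x; case: (psi x) => //= r _; rewrite ltNyr.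
Qed.

Lemma fine_minimizer_le x : edom F x -> fine (F xstar) <= fine (F x).
Proof.
move=> Fx; have := xstar_min x.
by rewrite (edom_fineK Fx) (edom_fineK (edom_minimizer Fx)) lee_fin.
Qed.

(** Minimality of [xstar] against strong convexity on the segment to [x] gives [(1 - t) a <= b] for
    [0 < t <= 1]; the claim is the limit [t -> 0]. *)
Lemma quadratic_growth x : edom F x ->
  mu / 2 * dotp (x - xstar) (x - xstar) <= fine (F x) - fine (F xstar).
Proof.
move=> Fx; have Fs := edom_minimizer Fx.
set a := mu / 2 * _; set b := _ - _.
have ab t : 0 < t <= 1 -> (1 - t) * a <= b.
  move=> /andP[t0 t1]; have t01 : 0 <= t <= 1 by rewrite ltW.
  have := le_trans (xstar_min _) (objective_strong_convexity Fx Fs t01).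
  rewrite {1}(edom_fineK Fs) lee_fin => h.
  rewrite -(ler_pM2l t0) /a /b; move: h; lra.
rewrite leNgt; apply/negP => ba.
have a0 : 0 < a by have := ab 2^-1 ltac:(lra); lra.
have b0 : 0 <= b by have := ab 1 ltac:(lra); lra.
(* If [b < a], this [t] makes [(1 - t) a] the midpoint of [a] and [b], which exceeds [b]; no limit
   has to be taken. *)
have := ab ((a - b) / (2 * a)).
have -> : (1 - (a - b) / (2 * a)) * a = (a + b) / 2.
  by field; rewrite gt_eqF.
have -> : 0 < (a - b) / (2 * a) <= 1.
  have a2 : 0 < 2 * a by lra.
  by rewrite divr_gt0 ?subr_gt0//= ler_pdivrMr//; lra.
by move=> /(_ isT); lra.
Qed.

(** Quadratic growth bounds the level set, so the supremum in [level_radius] is a true upper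
    bound. *)
Lemma level_radius_ge x0 x : edom F x0 -> (F x <= F x0)%E ->
  enorm (x - xstar) <= level_radius F x0 xstar.
Proof.
move=> F0 xx0; apply: ub_le_sup; last by exists x.
exists (Num.sqrt (2 / mu * (fine (F x0) - fine (F xstar)))) => _ [y /= yx0 <-].
have Fy : edom F y by exact: le_lt_trans yx0 F0.
apply: ler_wsqrtr; rewrite mulrAC ler_pdivlMr//.
have := quadratic_growth Fy.
have : fine (F y) <= fine (F x0).
  by have := yx0; rewrite (edom_fineK Fy) (edom_fineK F0) lee_fin.
lra.
Qed.

Variables (V : set (sketch_mx R d)) (psi' : 'cV[R]_d -> 'cV[R]_d).
Hypothesis V_rank : forall S, V S -> full_col_rank S.
Hypothesis psi'E : forall x, edom psi x ->
  psi x = (dotp (psi' x) (const_mx 1))%:E.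
Hypothesis psi'_sep : forall x y S, edom psi x -> edom psi y -> V S ->
  psi' (proj_range S *m x + (1%:M - proj_range S) *m y) =
  proj_range S *m psi' x + (1%:M - proj_range S) *m psi' y.
Hypothesis psi_sep : separable_set V (edom psi).

(** * Affine bound on the surrogate in [P], and its mean *)

Section AffineBound.
Variables (L p : R) (x v : 'cV[R]_d).
Hypotheses (Lx : loewner_le (hessian f x) L%:M) (p01 : 0 <= p <= 1).
Hypotheses (Fx : edom F x) (Fxv : edom F (x + v)).

(** Solving [<H (P v - p v), P v - p v> <= L |P v - p v|^2] for [<H P v, P v>], with
    [|P v|^2 = <P v, v>], leaves these terms free of [P]. *)
Definition affine_bound_cst : R := fine (F x)
  + 2^-1 * (L * p ^+ 2 * dotp v v - p ^+ 2 * dotp (hessian f x *m v) v).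

(** The vector paired with [P v]. The transpose comes from the cross term [<H P v, v>], as symmetry
    of the Hessian is not invoked; the last term comes from the cubic one. *)
Definition affine_bound_slope : 'cV[R]_d := gradient f x
  + 2^-1 *: ((L * (1 - 2 * p)) *: v + p *: (hessian f x *m v)
             + p *: ((hessian f x)^T *m v))
  + (M / 6 * enorm v) *: v.

(* The quadratic term is bounded through its expansion around the mean p v of
   P v, so that only the fluctuation P v - p v is multiplied by L. *)
Lemma surrogate_affine_bound S : V S ->
  (cubic_surrogate M x (proj_range S *m v) <=
   (affine_bound_cst + dotp (proj_range S *m v) affine_bound_slope
    + dotp (proj_range S *m (psi' (x + v) - psi' x)) (const_mx 1))%:E)%E.
Proof.
move=> VS; set P := proj_range S.
have px : edom psi x by exact/edom_objective.
have pxv : edom psi (x + v) by exact/edom_objective.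
(* The test point takes its component in the range from [x + v] and the rest from [x], the form to
   which separability applies. *)
have xPv : x + P *m v = P *m (x + v) + (1%:M - P) *m x.
  by rewrite mulmxDr mulmxBl mul1mx [P *m x + _]addrC addrACA subrr addr0 addrC.
rewrite /cubic_surrogate; have -> : psi (x + P *m v) = (dotp (psi' x) (const_mx 1)
    + dotp (P *m (psi' (x + v) - psi' x)) (const_mx 1))%:E.
  rewrite psi'E; last by rewrite xPv; exact: psi_sep.
  congr (_%:E); rewrite xPv psi'_sep// -dotpDl; congr (dotp _ _).
  by rewrite mulmxBl mul1mx mulmxBr addrCA.
have -> : affine_bound_cst = f x + dotp (psi' x) (const_mx 1)
    + 2^-1 * (L * p ^+ 2 * dotp v v - p ^+ 2 * dotp (hessian f x *m v) v).
  by rewrite /affine_bound_cst /F /objective psi'E.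
rewrite -EFinD lee_fin.
rewrite /affine_bound_slope !(dotpDr, dotpZr).
have rS := V_rank VS; have Pvv := proj_range_dotp v rS.
have cub : enorm (P *m v) ^+ 3 <= enorm v * dotp (P *m v) v.
  rewrite exprS sqr_enorm Pvv ler_wpM2r ?proj_range_enorm_le//.
  by rewrite -Pvv dotp_ge0.
have cubM : M / 6 * enorm (P *m v) ^+ 3 <= M / 6 * (enorm v * dotp (P *m v) v).
  by rewrite ler_wpM2l// divr_ge0// (lipschitz_hessian_ge0 fM).
have := psd_le (P *m v - p *: v) Lx; rewrite dotp_scalar mulmxBr -scalemxAr.
rewrite !(dotpDl, dotpDr, dotpNl, dotpNr, dotpZl, dotpZr) Pvv (dotpC v (P *m v)).
have -> : dotp (P *m v) ((hessian f x)^T *m v) = dotp (hessian f x *m (P *m v)) v.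
  by rewrite [RHS]dotp_mulmx.
rewrite (dotpC (P *m v) (hessian f x *m v)) (dotpC (gradient f x)).
move: cubM; lra.
Qed.

(** With [P] replaced by its mean, the variance leaves the [L] term. As
    [p^2 <H v, v> <= p <H v, v>], the Taylor lower bound produces [f (x + v)]; [M / 3] adds its
    [M / 6] to that of the surrogate. *)
Lemma affine_bound_mean :
  affine_bound_cst + p * dotp v affine_bound_slope
    + p * dotp (psi' (x + v) - psi' x) (const_mx 1) <=
  (1 - p) * fine (F x) + p * fine (F (x + v))
    + p * (1 - p) * L / 2 * dotp v v + p * M / 3 * enorm v ^+ 3.
Proof.
have px : edom psi x by exact/edom_objective.
have pxv : edom psi (x + v) by exact/edom_objective.
have -> : fine (F (x + v)) = f (x + v) + dotp (psi' (x + v)) (const_mx 1).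
  by rewrite /F /objective psi'E.
have fv : f x + dotp (gradient f x) v + dotp (hessian f x *m v) v / 2
    - M * enorm v ^+ 3 / 6 <= f (x + v).
  apply: (cubic_lower_bound f3) => y.
  by have := third_derivative_le f3 fM y v; rewrite ler_norml => /andP[].
have Hv : 0 <= dotp (hessian f x *m v) v.
  rewrite (le_trans _ (psd_le v (f_mu x)))// dotp_scalar mulr_ge0 ?dotp_ge0//.
  exact: ltW.
rewrite /affine_bound_cst /affine_bound_slope {1 2}/F /objective psi'E//=.
rewrite !(dotpDr, dotpZr, dotpDl, dotpNl) (dotpC v (gradient f x)).
rewrite (dotpC v (hessian f x *m v)) -dotp_mulmx.
have vvv : enorm v ^+ 3 = enorm v * dotp v v by rewrite exprS sqr_enorm.
have /andP[p0 p1] := p01.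
have := ler_wpM2l p0 fv; rewrite vvv.
have : p * (p * dotp (hessian f x *m v) v) <= p * dotp (hessian f x *m v) v.
  by rewrite ler_wpM2l// ler_piMl.
lra.
Qed.

End AffineBound.

(** Convexity yields a decrease [p b dl]. Quadratic growth bounds [|x - xstar|^2] by [2 dl / mu], so
    the conditions on [b] make each of the two error terms at most a quarter of that decrease. *)
Lemma contraction (L p b Rad : R) x v : 0 <= p <= 1 -> 0 <= b <= 1 ->
  edom F x -> enorm (x - xstar) <= Rad -> 0 <= L ->
  (1 - p) * (L / mu) * b <= 4^-1 -> 2 / 3 * (M * Rad / mu) * b ^+ 2 <= 4^-1 ->
  v = b *: (xstar - x) ->
  (1 - p) * fine (F x) + p * fine (F (x + v))
    + p * (1 - p) * L / 2 * dotp v v + p * M / 3 * enorm v ^+ 3 <=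
  fine (F xstar) + (1 - p * b / 2) * (fine (F x) - fine (F xstar)).
Proof.
move=> /andP[p0 p1] /andP[b0 b1] Fx xR L0 bL bM vE.
have Fs := edom_minimizer Fx; have M0 := lipschitz_hessian_ge0 fM d_gt0.
set dl := fine (F x) - fine (F xstar).
have dl0 : 0 <= dl by rewrite subr_ge0 fine_minimizer_le.
set r := enorm (x - xstar); have r0 : 0 <= r by exact: enorm_ge0.
have xs : xstar - x = - (x - xstar) by rewrite opprB.
have vv : dotp v v = b ^+ 2 * r ^+ 2.
  by rewrite vE xs dotpZl dotpZr dotpNl dotpNr opprK sqr_enorm mulrA.
have ev : enorm v = b * r.
  by rewrite /enorm vv -exprMn sqrtr_sqr ger0_norm// mulr_ge0.
have Fv : fine (F (x + v)) <= b * fine (F xstar) + (1 - b) * fine (F x).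
  have xv : x + v = b *: xstar + (1 - b) *: x.
    by rewrite vE; apply/matrixP => i j; rewrite !mxE; ring.
  have b01 : 0 <= b <= 1 by rewrite b0.
  have := objective_strong_convexity Fs Fx b01; rewrite -xv => h.
  have Fxv : edom F (x + v) by rewrite vE; exact: edom_segment.
  move: h; rewrite (edom_fineK Fxv) lee_fin => /le_trans; apply.
  rewrite lerBlDr lerDl !mulr_ge0 ?dotp_ge0 ?subr_ge0//; exact: ltW.
have r2 : r ^+ 2 <= 2 * dl / mu.
  by rewrite ler_pdivlMr// sqr_enorm; have := quadratic_growth Fx; rewrite -/dl; lra.
(* Only one factor [r] is bounded by [Rad]; the other two use quadratic growth, which keeps the cube
   proportional to the gap. *)
have r3 : r ^+ 3 <= Rad * (2 * dl / mu).
  by rewrite exprS ler_pM// exprn_ge0.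
have pF := ler_wpM2l p0 Fv.
have q0 : 0 <= 1 - p by rewrite subr_ge0.
have pb0 : 0 <= p * b * dl by rewrite !mulr_ge0.
have tL : p * (1 - p) * L / 2 * (b ^+ 2 * r ^+ 2) <= p * b * dl * 4^-1.
  apply: (@le_trans _ _ (p * (1 - p) * L / 2 * (b ^+ 2 * (2 * dl / mu)))).
    by rewrite ler_wpM2l ?mulr_ge0// ler_wpM2l ?exprn_ge0.
  rewrite [leLHS](_ : _ = p * b * dl * ((1 - p) * (L / mu) * b)); last first.
    by field; rewrite gt_eqF.
  by rewrite ler_wpM2l.
have tM : p * M / 3 * (b * r) ^+ 3 <= p * b * dl * 4^-1.
  apply: (@le_trans _ _ (p * M / 3 * (b ^+ 3 * (Rad * (2 * dl / mu))))).
    by rewrite ler_wpM2l ?divr_ge0 ?mulr_ge0// exprMn ler_wpM2l ?exprn_ge0.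
  rewrite [leLHS](_ : _ = p * b * dl * (2 / 3 * (M * Rad / mu) * b ^+ 2)); last first.
    by field; rewrite gt_eqF.
  by rewrite ler_wpM2l.
rewrite vv ev; move: pF tL tM; rewrite /dl; lra.
Qed.

End OneStep.

(** * Integrals *)

Section IntegralLemmas.
Context {R : realType}.
Local Open Scope ereal_scope.

(** Independence makes the law of [(X, Y)] agree with the product law on rectangles, hence
    everywhere; Tonelli's theorem for the nonnegative [g] does the rest. *)
Lemma integral_independent d0 d1 d2 (Omega : measurableType d0)
    (T1 : measurableType d1) (T2 : measurableType d2) (P : probability Omega R)
    (X : {RV P >-> T1}) (Y : {RV P >-> T2}) (g : T1 * T2 -> \bar R) :
  (forall A B, measurable A -> measurable B ->
    P (X @^-1` A `&` Y @^-1` B) = P (X @^-1` A) * P (Y @^-1` B)) ->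
  measurable_fun setT g -> (forall z, 0 <= g z) ->
  \int[P]_w g (X w, Y w) = \int[P]_w \int[distribution P Y]_t g (X w, t).
Proof.
move=> XY mg g0; pose Z w := (X w, Y w).
have mZ : measurable_fun setT Z by exact: measurable_fun_pair.
pose mZ_mixin := isMeasurableFun.Build _ _ _ _ _ mZ.
pose Z' : {mfun Omega >-> (T1 * T2)%type} := HB.pack Z mZ_mixin.
transitivity (\int[distribution P (Z' : {RV P >-> (T1 * T2)%type})]_z g z).
  by rewrite ge0_integral_distribution.
transitivity (\int[distribution P X \x distribution P Y]_z g z).
  apply: eq_measure_integral => A mA _; apply/esym.
  exact: product_measure_unique.
rewrite fubini_tonelli1// ge0_integral_distribution//.
  exact: measurable_fun_fubini_tonelli_F.
by move=> z; apply: integral_ge0 => t _; exact: g0.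
Qed.

Lemma ae_mono dT (T : measurableType dT) (mu : {measure set T -> \bar R})
    (A B : T -> Prop) :
  (forall t, A t -> B t) -> {ae mu, forall t, A t} -> {ae mu, forall t, B t}.
Proof. by move=> AB; apply: filterS. Qed.

Lemma ae_mono2 dT (T : measurableType dT) (mu : {measure set T -> \bar R})
    (A B C : T -> Prop) : (forall t, A t -> B t -> C t) ->
  {ae mu, forall t, A t} -> {ae mu, forall t, B t} -> {ae mu, forall t, C t}.
Proof. by move=> ABC; apply: filterS2. Qed.

Section Mean.
Context dT (T : measurableType dT) (D : probability T R).
Implicit Types (g : T -> R) (a c : R).

(** Integrability and value travel together, so that linearity can be applied repeatedly. *)
Definition has_mean g c :=
  D.-integrable setT (EFin \o g) /\ \int[D]_t (g t)%:E = c%:E.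

Lemma has_mean_cst c : has_mean (fun=> c) c.
Proof.
split; first exact: finite_measure_integrable_cst.
by rewrite integral_cst//= probability_setT mule1.
Qed.

Lemma has_meanD g1 c1 g2 c2 : has_mean g1 c1 -> has_mean g2 c2 ->
  has_mean (fun t => g1 t + g2 t)%R (c1 + c2).
Proof.
move=> [i1 e1] [i2 e2]; split; first exact: (integrableD measurableT i1 i2).
by rewrite EFinD -e1 -e2 -integralD.
Qed.

Lemma has_meanZ a g c : has_mean g c -> has_mean (fun t => a * g t)%R (a * c).
Proof.
move=> [i e]; split.
  rewrite [X in integrable _ _ X](_ : _ = (fun t => a%:E * (EFin \o g) t)).
    exact: integrableZl.
  by apply/funext => t /=; rewrite EFinM.
by under eq_integral do rewrite EFinM; rewrite EFinM -e -integralZl.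
Qed.

Lemma has_mean_sum (I : Type) (r : seq I) (g : I -> T -> R) (c : I -> R) :
  (forall i, has_mean (g i) (c i)) ->
  has_mean (fun t => \sum_(i <- r) g i t)%R (\sum_(i <- r) c i)%R.
Proof.
move=> gc; elim: r => [|i r IH].
  rewrite big_nil; under eq_fun do rewrite big_nil; exact: has_mean_cst.
by rewrite big_cons; under eq_fun do rewrite big_cons; exact: has_meanD.
Qed.

(** As [g] dominates the nonnegative [h] almost everywhere, truncating it at [0] changes it only on
    a null set and allows monotonicity for nonnegative integrands. *)
Lemma integral_le_mean (h : T -> \bar R) g c : measurable_fun setT h ->
  (forall t, 0 <= h t) -> has_mean g c -> {ae D, forall t, h t <= (g t)%:E} ->
  \int[D]_t h t <= c%:E.
Proof.
move=> mh h0 [/integrableP[mg _] <-] hg.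
have mm : measurable_fun setT (fun t => maxe 0 (g t)%:E).
  by apply: measurable_maxe => //; exact: measurable_cst.
rewrite [leRHS](_ : _ = \int[D]_t maxe 0 (g t)%:E).
  apply: ae_ge0_le_integral => //; first by move=> t _; rewrite le_max lexx.
  by apply: filterS hg => t ht _; rewrite le_max ht orbT.
apply: ae_eq_integral => //; apply: filterS hg => t ht _.
by rewrite max_r// (le_trans (h0 t)).
Qed.

Lemma integral_abs_le1 g : measurable_fun setT g ->
  {ae D, forall t, (`|g t| <= 1)%R} -> \int[D]_t `|(g t)%:E| <= 1.
Proof.
move=> mg g1; apply: (integral_le_mean _ _ (has_mean_cst 1)) => //.
  by apply: measurableT_comp => //; exact/measurable_EFinP.
Qed.

End Mean.

(** * The mean of the random projection *)

Context {d : nat}.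
Variables (D : probability (borel (sketch_mx R d)) R) (p : R).
Hypothesis D_rank : {ae D, forall T, full_col_rank T}.
Hypothesis D_mean : forall i j,
  'E_D[fun T => proj_range T i j] = ((p%:M : 'M[R]_d) i j)%:E.

Let measurable_proj i j :
  measurable_fun setT (fun T : borel (sketch_mx R d) => proj_range T i j) :=
  proj_range_measurable i j.

Let proj_range_abs i j : \int[D]_T `|(proj_range T i j)%:E| <= 1.
Proof.
apply: integral_abs_le1; first exact: measurable_proj.
by move: D_rank; apply: ae_mono => T; exact: proj_range_coef_le1.
Qed.

Lemma proj_range_has_mean i j :
  has_mean D (fun T => proj_range T i j) ((p%:M : 'M[R]_d) i j).
Proof.
split; last by rewrite -D_mean unlock.
apply/integrableP; split; first by apply/measurable_EFinP; exact: measurable_proj.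
by apply: le_lt_trans (proj_range_abs i j) _; rewrite ltry.
Qed.

(** [p] is the mean of a diagonal entry, and entries of projections are at most [1]; [0 < d]
    provides the index. *)
Lemma mean_proj_range_le1 : (0 < d)%N -> (p <= 1)%R.
Proof.
move=> d0; pose i := Ordinal d0; rewrite -lee_fin.
have := (proj_range_has_mean i i).2; rewrite mxE eqxx mulr1n => <-.
apply: le_trans (proj_range_abs i i); apply: le_trans (lee_abs _) _.
by apply: le_abse_integral => //; apply/measurable_EFinP; exact: measurable_proj.
Qed.

Lemma proj_range_dotp_mean (v z : 'cV[R]_d) :
  has_mean D (fun T => dotp (proj_range T *m v) z) (p * dotp v z)%R.
Proof.
have -> : (p * dotp v z)%R =
    (\sum_i \sum_j (v j ord0 * z i ord0) * (p%:M : 'M[R]_d) i j)%R.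
  rewrite -dotpZl -mul_scalar_mx; apply: eq_bigr => i _.
  by rewrite mxE big_distrl; apply: eq_bigr => j _ /=; ring.
have -> : (fun T : borel (sketch_mx R d) => dotp (proj_range T *m v) z) =
    (fun T => \sum_i \sum_j (v j ord0 * z i ord0) * proj_range T i j)%R.
  apply/funext => T; apply: eq_bigr => i _.
  by rewrite mxE big_distrl; apply: eq_bigr => j _ /=; ring.
apply: has_mean_sum => i; apply: has_mean_sum => j; apply: has_meanZ.
exact: proj_range_has_mean.
Qed.

End IntegralLemmas.

(** * The expected gap *)

Section SurrogateMeasurability.
Context {R : realType} {d : nat}.
Variables (f : 'cV[R]_d -> R) (psi : 'cV[R]_d -> \bar R).
Let F := objective f psi.
Hypotheses (f3 : three_times_differentiable f) (psi_closed : closed_fun psi).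

Let gradient_measurable :
  entrywise_measurable (gradient f : borel 'cV[R]_d -> 'cV[R]_d).
Proof.
have [_ gd _] := f3.
move=> i j; apply: continuous_borel_measurable => x.
apply: (@continuous_comp _ _ _ (gradient f) (fun A : 'cV[R]_d => A i j)).
  exact: differentiable_continuous.
exact: coord_continuous.
Qed.

Let hessian_measurable :
  entrywise_measurable (hessian f : borel 'cV[R]_d -> 'M[R]_d).
Proof.
have [_ _ hd] := f3.
move=> i j; apply: continuous_borel_measurable => x.
apply: (@continuous_comp _ _ _ (hessian f) (fun A : 'M[R]_d => A i j)).
  exact: differentiable_continuous.
exact: coord_continuous.
Qed.

Let f_measurable : measurable_fun setT (f : borel 'cV[R]_d -> R).
Proof.
have [fd _ _] := f3; apply: continuous_borel_measurable => x.
exact: differentiable_continuous.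
Qed.

Lemma objective_measurable : measurable_fun setT (F : borel 'cV[R]_d -> \bar R).
Proof.
apply: emeasurable_funD; first exact/measurable_EFinP.
exact: closed_fun_measurable.
Qed.

Lemma surrogate_measurable dT (T : measurableType dT) (M : R)
    (X : T -> borel 'cV[R]_d) (u : T -> 'cV[R]_d) :
  measurable_fun setT X -> entrywise_measurable u ->
  measurable_fun setT (fun t => cubic_surrogate f psi M (X t) (u t)).
Proof.
move=> mX mu.
have mg : entrywise_measurable (fun t => gradient f (X t)).
  by move=> i j; exact: measurableT_comp (gradient_measurable i j) mX.
have mH : entrywise_measurable (fun t => hessian f (X t)).
  by move=> i j; exact: measurableT_comp (hessian_measurable i j) mX.
apply: emeasurable_funD.
  apply/measurable_EFinP; apply: measurable_funD.
    apply: measurable_funD; last first.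
      apply: measurable_funM => //; apply: measurable_dotp => //.
      exact: entrywise_measurableM.
    apply: measurable_funD; first exact: measurableT_comp f_measurable mX.
    exact: measurable_dotp.
  apply: measurable_funM => //; apply: measurable_funX.
  have ms := @continuous_measurable_fun R _ (@sqrt_continuous R).
  by apply: (measurableT_comp ms); exact: measurable_dotp.
apply: (measurableT_comp (closed_fun_measurable psi_closed)).
apply: measurable_borel_mx; apply: entrywise_measurableD => //.
exact: entrywise_measurable_comp.
Qed.

End SurrogateMeasurability.

(** * Geometric decay and the choice of the step length *)

Section Rate.
Context {R : realType}.

(** Since [1 - rho <= expR (- rho)], the power is at most [expR (- k rho)], hence at most
    [eps / delta] by the condition on [k]. *)
Lemma geometric_decay (rho delta eps : R) (k : nat) : 0 < rho <= 1 -> 0 < eps ->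
  0 < delta -> rho^-1 * ln (delta / eps) <= k%:R ->
  (1 - rho) ^+ k * delta <= eps.
Proof.
move=> /andP[rho0 rho1] eps0 delta0; rewrite ler_pdivrMl// => hk.
rewrite -ler_pdivlMr//; apply: (@le_trans _ _ (expR (- rho) ^+ k)).
  by rewrite lerXn2r ?nnegrE ?subr_ge0 ?expR_ge0// expR_ge1Dx.
rewrite -expRM_natl -[leRHS]lnK ?posrE ?divr_gt0// ler_expR.
by rewrite -[eps / delta]invf_div lnV ?posrE ?divr_gt0// mulrN lerN2 [_ * rho]mulrC.
Qed.

(** [b] is the inverse of a sum [A] that exceeds each of its nonnegative terms: [4 (1 - p) q <= A]
    gives the second bound, and [4 s <= A^2] the third with room to spare. Used with [q = L / mu]
    and [s = M Rad / mu]. *)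
Lemma step_length_bounds (p q s b : R) : 0 <= p <= 1 -> 0 <= q -> 0 <= s ->
  b = (1 + 4 * (1 - p) * q + 2 * Num.sqrt s)^-1 ->
  [/\ 0 < b <= 1, (1 - p) * q * b <= 4^-1 & 2 / 3 * s * b ^+ 2 <= 4^-1].
Proof.
move=> /andP[p0 p1] q0 s0; have r0 := sqrtr_ge0 s.
have pq : 0 <= (1 - p) * q by rewrite mulr_ge0// subr_ge0.
set A := 1 + _ + _ => ->.
have A1 : 1 <= A by rewrite /A; lra.
have A0 : 0 < A by lra.
split; first by rewrite invr_gt0 A0 invf_le1.
  by rewrite ler_pdivrMr// /A; lra.
rewrite exprVn ler_pdivrMr ?exprn_gt0// -[in leLHS](sqr_sqrtr s0).
have : (2 * Num.sqrt s) ^+ 2 <= A ^+ 2.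
  by rewrite lerXn2r ?nnegrE ?mulr_ge0 ?(ltW A0)//; rewrite /A; lra.
by rewrite exprMn; have := sqr_ge0 A; lra.
Qed.

End Rate.

(** * The recursion for the expected gap *)

Section ExpectedGap.
Context {R : realType} {d : nat}.
Variables (f : 'cV[R]_d -> R) (psi : 'cV[R]_d -> \bar R).
Let F := objective f psi.
Hypotheses (d_gt0 : (0 < d)%N) (f3 : three_times_differentiable f).
Variable M : R.
Hypothesis fM : lipschitz_hessian M f.
Hypotheses (psi_proper : forall x, psi x != -oo%E) (psi_closed : closed_fun psi).
Hypothesis psi_convex : convex_efun psi.
Variable mu : R.
Hypotheses (mu_gt0 : 0 < mu) (f_mu : forall y, loewner_le mu%:M (hessian f y)).
Variables (x0 xstar : 'cV[R]_d).
Hypothesis xstar_min : forall y, (F xstar <= F y)%E.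
Hypothesis F0 : edom F x0.
Variables (D : probability (borel (sketch_mx R d)) R) (V : set (sketch_mx R d)).
Variable psi' : 'cV[R]_d -> 'cV[R]_d.
Hypothesis V_rank : forall S, V S -> full_col_rank S.
Hypothesis V_ae : {ae D, forall S, V S}.
Hypothesis psi'E : forall x, edom psi x ->
  psi x = (dotp (psi' x) (const_mx 1))%:E.
Hypothesis psi'_sep : forall x y S, edom psi x -> edom psi y -> V S ->
  psi' (proj_range S *m x + (1%:M - proj_range S) *m y) =
  proj_range S *m psi' x + (1%:M - proj_range S) *m psi' y.
Hypothesis psi_sep : separable_set V (edom psi).
Variables (p L b : R).
Hypothesis D_mean : forall i j,
  'E_D[fun T => proj_range T i j]%E = ((p%:M : 'M[R]_d) i j)%:E.
Hypotheses (p_ge0 : 0 <= p) (L_ge0 : 0 <= L).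
Hypothesis f_L : forall y, (F y <= F x0)%E -> loewner_le (hessian f y) L%:M.
Hypotheses (b01 : 0 <= b <= 1) (bL : (1 - p) * (L / mu) * b <= 4^-1).
Hypothesis bM :
  2 / 3 * (M * level_radius F x0 xstar / mu) * b ^+ 2 <= 4^-1.

Let Fs : edom F xstar.
Proof. exact: edom_minimizer F0. Qed.

Let F_fineK y : edom F y -> F y = (fine (F y))%:E.
Proof. exact: edom_fineK. Qed.

Let Fs_fineK : F xstar = (fine (F xstar))%:E.
Proof. exact: edom_fineK. Qed.

Let Fs_fin_num : F xstar \is a fin_num.
Proof. by rewrite Fs_fineK. Qed.

Let gap (y : 'cV[R]_d) : \bar R := (F y - F xstar)%E.

Let gap_ge0 y : (0 <= gap y)%E.
Proof. by rewrite /gap sube_ge0// Fs_fin_num. Qed.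

Let surrogate_gap (z : borel 'cV[R]_d * borel (sketch_mx R d)) : \bar R :=
  (cubic_surrogate f psi M z.1 (proj_range z.2 *m (b *: (xstar - z.1)))
   - F xstar)%E.

Let surrogate_gap_ge0 z : (0 <= surrogate_gap z)%E.
Proof.
rewrite /surrogate_gap sube_ge0 ?Fs_fin_num//.
exact: le_trans (xstar_min _) (objective_le_surrogate _ f3 fM _ _).
Qed.

Let measurable_gap : measurable_fun setT (gap : borel 'cV[R]_d -> \bar R).
Proof.
apply: emeasurable_funB; last exact: measurable_cst.
exact: objective_measurable.
Qed.

Let measurable_surrogate_gap : measurable_fun setT surrogate_gap.
Proof.
have m1 := entrywise_measurable_comp
  (@measurable_fst _ _ (borel 'cV[R]_d) (borel (sketch_mx R d))).
have m2 : entrywise_measurable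
    (fun z : borel 'cV[R]_d * borel (sketch_mx R d) =>
       proj_range z.2 *m (b *: (xstar - z.1))).
  apply: entrywise_measurableM.
    move=> i j; apply: (measurableT_comp (proj_range_measurable i j)).
    exact: measurable_snd.
  move=> i j; under eq_fun do rewrite !mxE.
  apply: measurable_funM; first exact: measurable_cst.
  by apply: measurable_funD; [exact: measurable_cst|exact: measurable_funN (m1 i j)].
apply: (emeasurable_funB _ (measurable_cst _)).
exact: (surrogate_measurable f3 psi_closed M measurable_fst m2).
Qed.

Let rank_ae : {ae D, forall T, full_col_rank T}.
Proof. by move: V_ae; apply: ae_mono => T; exact: V_rank. Qed.

Let p01 : 0 <= p <= 1.
Proof. by rewrite p_ge0 (mean_proj_range_le1 rank_ae D_mean). Qed.

(** The current point is frozen and only the sketch is random: the affine bound holds on [V], hence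
    almost everywhere, its mean is explicit, and [contraction] concludes. *)
Lemma expected_surrogate_gap_le y : (F y <= F x0)%E ->
  (\int[D]_T surrogate_gap (y, T) <=
   ((1 - p * b / 2) * fine (gap y))%:E)%E.
Proof.
move=> yx0; have Fy : edom F y by exact: le_lt_trans yx0 F0.
pose v := b *: (xstar - y).
have Fyv : edom F (y + v) by exact: (edom_segment f3).
have gapE : fine (gap y) = fine (F y) - fine (F xstar).
  by rewrite /gap {1}(F_fineK Fy) {1}Fs_fineK.
apply: (@le_trans _ _ (affine_bound_cst f psi L p y v
    + p * dotp v (affine_bound_slope f M L p y v)
    + p * dotp (psi' (y + v) - psi' y) (const_mx 1) - fine (F xstar))%:E).
  apply: (@integral_le_mean _ _ _ D (fun T => surrogate_gap (y, T))
    (fun T : borel (sketch_mx R d) => affine_bound_cst f psi L p y v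
      + dotp (proj_range T *m v) (affine_bound_slope f M L p y v)
      + dotp (proj_range T *m (psi' (y + v) - psi' y)) (const_mx 1)
      - fine (F xstar))).
  - exact: (@measurable_fun_pair2 _ _ _ (borel 'cV[R]_d) (borel (sketch_mx R d)) _
      surrogate_gap y measurable_surrogate_gap).
  - by move=> T; exact: surrogate_gap_ge0.
  - have mean := proj_range_dotp_mean rank_ae D_mean.
    exact: (has_meanD (has_meanD (has_meanD (has_mean_cst D _) (mean _ _))
      (mean _ _)) (has_mean_cst D _)).
  - move: V_ae; apply: ae_mono => T VT.
    rewrite /surrogate_gap Fs_fineK EFinB leeB//=.
    exact: (surrogate_affine_bound d_gt0 fM psi_proper V_rank psi'E psi'_sep
      psi_sep p (f_L yx0) Fy Fyv VT).
rewrite lee_fin gapE lerBlDl.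
apply: (le_trans (affine_bound_mean f3 fM psi_proper mu_gt0 f_mu psi'E
  L p01 Fy Fyv)).
apply: (contraction d_gt0 f3 fM psi_proper psi_convex mu_gt0 f_mu xstar_min
  p01 b01 Fy _ L_ge0 bL bM) => //.
exact: (level_radius_ge f3 psi_proper psi_convex mu_gt0 f_mu).
Qed.

Context {dO : measure_display} {Omega : measurableType dO}.
Variable P : probability Omega R.
Variable S : nat -> {RV P >-> borel (sketch_mx R d)}.
Variable x : nat -> {RV P >-> borel 'cV[R]_d}.
Hypothesis x_sscn : is_sscn f psi S x D x0.

(** [S k] has law [D], so the preimage of a measurable [D]-null set [N] containing the complement of
    [V] is [P]-null. *)
Lemma range_ae k : {ae P, forall w, V (S k w)}.
Proof.
have [_ SD _ _] := x_sscn; have [N [mN N0 nVN]] := V_ae.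
exists (S k @^-1` N); split.
- by rewrite -[X in measurable X]setTI; exact: measurable_funP.
- by have := SD k N mN; rewrite N0.
- by move=> w /= nV; exact: nVN.
Qed.

(** Steps never increase the objective, so the iterates stay almost surely in the initial level set,
    where [L] and the radius are in force. *)
Lemma level_ae k : {ae P, forall w, (F (x k w) <= F x0)%E}.
Proof.
have [xx0 _ _ xS] := x_sscn; elim: k => [|k IH].
  by apply: aeW => w; rewrite xx0.
apply: (ae_mono2 _ IH); last first.
  apply: (ae_mono2 _ (range_ae k) (xS k)) => w Vw Sw.
  exact: (sscn_step_le f3 fM (V_rank Vw) Sw).
by move=> w /= h1 h2; exact: le_trans h2 h1.
Qed.

Let measurable_gap_x k : measurable_fun setT (fun w => gap (x k w)).
Proof. exact: (measurableT_comp measurable_gap). Qed.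

Lemma expected_gap_step k :
  (\int[P]_w gap (x k.+1 w) <= (1 - p * b / 2)%:E * \int[P]_w gap (x k w))%E.
Proof.
have [_ SD xS_indep xS] := x_sscn.
have q0 : 0 <= 1 - p * b / 2.
  by have /andP[? ?] := p01; have /andP[? ?] := b01; nra.
apply: (@le_trans _ _ (\int[P]_w surrogate_gap (x k w, S k w))%E).
  apply: ae_ge0_le_integral => //.
    apply: (measurableT_comp measurable_surrogate_gap).
    exact: measurable_fun_pair.
  apply: (ae_mono2 _ (range_ae k) (xS k)) => w Vw Sw _.
  rewrite /gap /surrogate_gap leeB//.
  exact: (sscn_step_surrogate d_gt0 f3 fM _ (V_rank Vw) Sw).
rewrite integral_independent//; last first.
  (* Independence from the past is used for events on [x k], which is among the generators of
     [past k]. *)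
  move=> A B mA mB; apply: xS_indep => //; apply: sub_sigma_algebra; left.
  by exists k; [exact: ltnSn|exists A => //; rewrite setTI].
rewrite -ge0_integralZl//.
apply: ae_ge0_le_integral => //.
- by move=> w _; apply: integral_ge0 => T _; exact: surrogate_gap_ge0.
- apply: (measurableT_comp
    (measurable_fun_fubini_tonelli_F _ measurable_surrogate_gap _)) => //.
- by move=> w _; rewrite mule_ge0.
- by apply: measurable_funeM.
apply: (ae_mono _ (level_ae k)) => w xw _.
(* The inner integral against the law of [S k] is one against [D], at a fixed point of the level
   set. *)
rewrite (@eq_measure_integral _ _ _ _ D); last by move=> A mA _; exact: SD.
apply: (le_trans (expected_surrogate_gap_le xw)).
rewrite EFinM lee_wpmul2l// fineK//.
by rewrite /gap fin_numB Fs_fin_num (F_fineK (le_lt_trans xw F0)).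
Qed.

Lemma expected_gap_le k :
  (\int[P]_w gap (x k w) <= ((1 - p * b / 2) ^+ k * fine (gap x0))%:E)%E.
Proof.
have q0 : 0 <= 1 - p * b / 2.
  by have /andP[? ?] := p01; have /andP[? ?] := b01; nra.
have [xx0 _ _ _] := x_sscn.
elim: k => [|k IH].
  rewrite expr0 mul1r; under eq_integral do rewrite xx0.
  rewrite integral_cst//= probability_setT mule1 fineK//.
  by rewrite /gap fin_numB Fs_fin_num (F_fineK F0).
apply: (le_trans (expected_gap_step k)).
by rewrite exprS -[_ * _ ^+ k * _]mulrA EFinM lee_wpmul2l.
Qed.

(** The gap is nonnegative with finite expectation, hence integrable, so the constant [F xstar] can
    be split off. *)
Lemma expected_objective_le k :
  (\int[P]_w F (x k w) - F xstar <=
   ((1 - p * b / 2) ^+ k * fine (gap x0))%:E)%E.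
Proof.
rewrite (_ : (\int[P]_w F (x k w))%E = (\int[P]_w gap (x k w) + F xstar)%E).
  by rewrite addeK ?Fs_fin_num// expected_gap_le.
have i1 : P.-integrable setT (fun w => gap (x k w)).
  apply/integrableP; split; first exact: measurable_gap_x.
  under eq_integral do rewrite gee0_abs//.
  exact: le_lt_trans (expected_gap_le k) (ltry _).
have i2 : P.-integrable setT (fun=> F xstar).
  by rewrite Fs_fineK; exact: finite_measure_integrable_cst.
rewrite -[in RHS](mule1 (F xstar)) -(@probability_setT _ _ _ P) -integral_cst//.
rewrite -integralD//; apply: eq_integral => w _.
by rewrite /gap subeK// Fs_fin_num.
Qed.

End ExpectedGap.

(** * The iteration complexity *)

Theorem theorem5p10 (R : realType) :
  exists C : R, 0 < C /\
  forall (d : nat) (f : 'cV[R]_d -> R) (psi : 'cV[R]_d -> \bar R)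
    (M mu tau L : R) (x0 xstar : 'cV[R]_d)
    (D : probability (borel (sketch_mx R d)) R) (V : set (sketch_mx R d))
    (dO : measure_display) (Omega : measurableType dO)
    (P : probability Omega R)
    (S : nat -> {RV P >-> borel (sketch_mx R d)})
    (x : nat -> {RV P >-> borel 'cV[R]_d}),
  let F := objective f psi in
  let Rad := level_radius F x0 xstar in
  convex_function [set: 'cV[R]_d] f ->
  three_times_differentiable f ->
  lipschitz_hessian M f ->
  proper_fun psi -> closed_fun psi -> convex_efun psi ->
  (forall y, (F xstar <= F y)%E) ->
  0 < mu ->
  (forall y, loewner_le mu%:M (hessian f y)) ->
  {ae D, forall T, full_col_rank T} ->
  0 < tau ->
  (forall i j, 'E_D[fun T => proj_range T i j]%E
               = ((tau / d%:R)%:M i j : R)%:E) ->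
  is_range D V ->
  separable_fun V psi ->
  edom F x0 ->
  is_sscn f psi S x D x0 ->
  (forall y, (F y <= F x0)%E -> loewner_le (hessian f y) L%:M) ->
  forall eps : R, 0 < eps -> (eps%:E < F x0 - F xstar)%E ->
  forall k : nat,
    C * ((d%:R - tau) / tau * (L / mu)
         + d%:R / tau * Num.sqrt (M * Rad / mu) + d%:R / tau)
      * ln (fine (F x0 - F xstar)%E / eps) <= k%:R ->
    (\int[P]_w F (x k w) - F xstar <= eps%:E)%E.
Proof.
(* The contraction rate is [rho = p / (2 A)], and [1 / rho = 2 A / p] with
   [2 A = 2 + 8 (1 - p) L / mu + 4 r], where [r] is the square root of [M Rad / mu]; [8] is the
   largest coefficient. *)
exists 8; split => // d f psi M mu tau L x0 xstar D V dO Omega P S x F Rad _ f3 fM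
  [psi_proper _] psi_closed psi_convex xstar_min mu_gt0 f_mu _ tau_gt0 D_mean
  [V_rank V_ae] [psi_sep [psi' [psi'E psi'_sep]]] F0 x_sscn f_L eps eps_gt0 gap_eps
  k hk.
have Fs := edom_minimizer xstar_min F0.
have Fx0 := edom_fineK psi_proper F0.
have Fxs := edom_fineK psi_proper Fs.
pose delta := fine (F x0 - F xstar)%E.
have gapE : (F x0 - F xstar)%E = delta%:E.
  by rewrite /delta fineK// fin_numB /F Fx0 Fxs.
have delta_eps : eps < delta by rewrite -lte_fin -gapE.
(* In dimension [0] the space is a single point, so the initial gap vanishes, against
   [0 < eps < delta]. *)
case: (posnP d) => [d0|d_gt0].
  exfalso; move: delta_eps; suff -> : delta = 0 by rewrite ltNge (ltW eps_gt0).
  have -> : delta = fine (F x0) - fine (F xstar).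
    by rewrite /delta /F {1}Fx0 {1}Fxs.
  suff -> : x0 = xstar by rewrite subrr.
  by clear -d0; subst d; rewrite (flatmx0 x0) (flatmx0 xstar).
pose p := tau / d%:R.
have dR_gt0 : 0 < d%:R :> R by rewrite ltr0n.
have p_gt0 : 0 < p by exact: divr_gt0.
have rank_ae : {ae D, forall T, full_col_rank T}.
  by move: V_ae; apply: ae_mono => T; exact: V_rank.
have p_le1 : p <= 1 by exact: mean_proj_range_le1 rank_ae D_mean d_gt0.
have p01 : 0 <= p <= 1 by rewrite ltW.
(* Both Loewner bounds at [x0], tested on the all-ones vector, give [mu <= L]. *)
have L_ge0 : 0 <= L.
  pose u : 'cV[R]_d := const_mx 1.
  have u0 : 0 < dotp u u.
    rewrite /dotp; under eq_bigr do rewrite !mxE mulr1.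
    by rewrite sumr_const card_ord.
  have := le_trans (psd_le u (f_mu x0)) (psd_le u (f_L x0 (lexx _))).
  by rewrite !dotp_scalar ler_pM2r// => /(le_trans _); apply; exact: ltW.
have Rad_ge0 : 0 <= Rad.
  apply: le_trans (enorm_ge0 (x0 - xstar)) _.
  exact: (level_radius_ge f3 psi_proper psi_convex mu_gt0 f_mu xstar_min F0).
have M_ge0 := lipschitz_hessian_ge0 fM d_gt0.
have q_ge0 : 0 <= L / mu by rewrite divr_ge0// ltW.
have s_ge0 : 0 <= M * Rad / mu by rewrite divr_ge0 ?mulr_ge0// ltW.
have [/andP[b_gt0 b_le1] bL bM] := step_length_bounds p01 q_ge0 s_ge0 erefl.
move: b_gt0 b_le1 bL bM; set A := 1 + _ + _ => b_gt0 b_le1 bL bM.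
have A_gt0 : 0 < A by rewrite -invr_gt0.
have b01 : 0 <= A^-1 <= 1 by rewrite ltW.
apply: le_trans (expected_objective_le d_gt0 f3 fM psi_proper psi_closed psi_convex
  mu_gt0 f_mu xstar_min F0 V_rank V_ae psi'E psi'_sep psi_sep D_mean (ltW p_gt0)
  L_ge0 f_L b01 bL bM x_sscn k) _.
rewrite lee_fin; apply: geometric_decay => //.
- have pb1 : p * A^-1 <= 1 by rewrite mulr_ile1// ltW.
  have pb0 : 0 < p * A^-1 by rewrite mulr_gt0.
  by rewrite divr_gt0//= ler_pdivrMr// mul1r (le_trans pb1)// ler1n.
- exact: lt_trans eps_gt0 delta_eps.
apply: le_trans hk; rewrite ler_wpM2r//.
  by rewrite ln_ge0// ler_pdivlMr// mul1r ltW.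
have -> : d%:R / tau = p^-1 by rewrite invf_div.
have -> : (d%:R - tau) / tau = (1 - p) / p.
  by rewrite /p; field; rewrite !gt_eqF.
have -> : (p / A / 2)^-1 = 2 * A / p by field; rewrite !gt_eqF.
rewrite ler_pdivrMr// /A.
set r := Num.sqrt _; have r_ge0 : 0 <= r by exact: sqrtr_ge0.
rewrite [leRHS](_ : _ = 8 * ((1 - p) * (L / mu) + r + 1)); last first.
  by field; rewrite gt_eqF//= gt_eqF.
lra.
Qed.
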